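(* Let $\mathbf p$ be an offspring distribution with $\mathbf p(0)+\mathbf p(1)<1$, with finite mean and $\mathbf p(0)>0$, and let $\mathbf q$ be a mark function such that $\mathbf p(k)\mathbf q(k)>0$ for some $k\in\mathbb N$. Let $\mathbb P$ be the distribution of the marked Galton-Watson tree with offspring distribution $\mathbf p$ and mark function $\mathbf q$. Let $s\in(0,1)$ and let $\kappa(s)$ be the unique fixed point in $[0,1]$ of $f_s(t)=\mathbb E[s^{M_1}t^{Z_1}]$. The probability measure $\mathbb Q_{s,2}$ on $(\mathbb T^*,\mathscr F)$ defined by $$\forall n\in\mathbb N,\ \forall\Lambda_n\in\mathscr F_n,\quad \mathbb Q_{s,2}(\Lambda_n)=\mathbb E\left[\mathbf 1_{\Lambda_n}\frac{s^{M_n}Z_n\kappa(s)^{Z_n-1}}{f_s'(\kappa(s))^n}\right]$$ is the distribution of the special random marked tree $\tau_{s,2}$ defined in the context.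
   Context: $\mathbb N=\{0,1,2,\dots\}$, $\mathbb N^*=\{1,2,\dots\}$. Let $\mathscr U=\bigcup_{n\ge0}(\mathbb N^* )^n$ be the set of finite sequences of positive integers, $|u|$ the length of $u$, $\emptyset$ the empty sequence. A tree $\mathbf t$ is a subset of $\mathscr U$ such that $\emptyset\in\mathbf t$; $uj\in\mathbf t\Rightarrow u\in\mathbf t$ (for $j\in\mathbb N^*$); and for each $u\in\mathbf t$ there is $k_u(\mathbf t)\in\mathbb N$ with $ui\in\mathbf t\iff i\le k_u(\mathbf t)$. A marked tree is $\mathbf t^*=(\mathbf t,(\eta_u)_{u\in\mathbf t})$ with $\eta_u\in\{0,1\}$; $\mathbb T^*$ is the set of marked trees. For $n\in\mathbb N$, $r_n^*(\mathbf t^* )$ is the marked tree consisting of the nodes $u\in\mathbf t$ with $|u|\le n$, keeping the marks of nodes with $|u|\le n-1$ and setting the marks at level $n$ to $0$. $\mathscr F_n$ is the $\sigma$-field on $\mathbb T^*$ generated by $r_n^*$, and $\mathscr F=\bigvee_n\mathscr F_n$. $Z_n(\mathbf t^* )$ is the number of nodes $u\in\mathbf t$ with $|u|=n$; $M_0=0$ and $M_n(\mathbf t^* )=\sum_{u\in\mathbf t,|u|\le n-1}\eta_u$ for $n\ge1$. An offspring distribution is a probability distribution $\mathbf p$ on $\mathbb N$; a mark function is a map $\mathbf q:\mathbb N\to[0,1]$. Set $\mathbf p_0(k,1)=\mathbf p(k)\mathbf q(k)$, $\mathbf p_0(k,0)=\mathbf p(k)(1-\mathbf q(k))$. The marked Galton-Watson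 tree distribution $\mathbb P$ is the unique probability measure on $(\mathbb T^*,\mathscr F)$ such that, with $\tau^*$ the identity map of $\mathbb T^*$, for all $h\ge1$ and $\mathbf t^*\in\mathbb T^*$, $\mathbb P(r_h^*(\tau^* )=r_h^*(\mathbf t^* ))=\prod_{u\in\mathbf t,|u|\le h-1}\mathbf p_0(k_u(\mathbf t),\eta_u)$. $\mathbb E$ is the expectation under $\mathbb P$, and $Z_n=Z_n(\tau^* )$, $M_n=M_n(\tau^* )$. Special random marked tree $\tau_{s,2}$: a random marked tree whose nodes are either normal or special. The root is special. Given the tree up to generation $n$ and the special node of generation $n$, the nodes of generation $n$ choose their number of children and their mark independently: a normal node has $k$ children and mark $\eta$ with probability $p_{s,0}(k,\eta)=\mathbf p_0(k,\eta)s^\eta\kappa(s)^{k-1}$; the special node has $k$ children and mark $\eta$ with probability $p_{s,1}(k,\eta)=p_{s,0}(k,\eta)\,k/f_s'(\kappa(s))$. At each generation, conditionally given the tree up to that generation, there is a unique special node, chosen uniformly among all the individuals of that generation (independently of the previous special nodes). *)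

(* Defs.v *)
From HB Require Import structures.
From mathcomp Require Import all_boot all_order all_algebra.
From mathcomp Require Import finmap.
From mathcomp Require Import all_classical all_reals all_analysis.

Set Implicit Arguments.
Unset Strict Implicit.
Unset Printing Implicit Defensive.

Import Order.TTheory GRing.Theory Num.Theory.
Import numFieldNormedType.Exports.

Local Open Scope classical_set_scope.
Local Open Scope ring_scope.

(* The marks (eta_u) of the nodes are encoded by the set [marked] of the nodes
   of mark 1, so that two marked trees with the same nodes and the same marks
   are equal. *)
Record mtree := MTree {
  nodes : set (seq nat) ;
  marked : set (seq nat) ;
  nodes_pos : forall u, nodes u -> all (leq 1) u ;
  nodes_root : nodes [::] ;
  nodes_parent : forall u j, nodes (rcons u j) -> nodes u ;
  nodes_children : forall u, nodes u ->
    exists k : nat, forall i, (0 < i)%N -> nodes (rcons u i) <-> (i <= k)%N ;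
  marked_nodes : marked `<=` nodes }.

Definition eta (t : mtree) (u : seq nat) : bool := u \in marked t.

Definition nchild (t : mtree) (u : seq nat) : nat :=
  get [set k : nat |
    forall i, (0 < i)%N -> nodes t (rcons u i) <-> (i <= k)%N].

Lemma nchildP (t : mtree) (u : seq nat) : nodes t u ->
  forall i, (0 < i)%N -> nodes t (rcons u i) <-> (i <= nchild t u)%N.
Proof. by move=> /nodes_children tu; exact: (xgetPex 0%N tu). Qed.

Definition level (t : mtree) (n : nat) : set (seq nat) :=
  [set u | nodes t u /\ size u = n].

Definition below (t : mtree) (n : nat) : set (seq nat) :=
  [set u | nodes t u /\ (size u < n)%N].

Lemma finite_level (t : mtree) (n : nat) : finite_set (level t n).
Proof.
elim: n => [|n IHn].
  by apply: (sub_finite_set _ (finite_set1 [::])) => u [_ /size0nil].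
apply: (@sub_finite_set _ _
  (\bigcup_(u in level t n) [set rcons u i | i in `I_(nchild t u).+1])).
  move=> u [tu su]; case/lastP: u => // u j in tu su *.
  have tu' := nodes_parent tu; move: su; rewrite size_rcons => -[su].
  exists u => //; exists j => //=; rewrite ltnS; apply/(nchildP tu') => //.
  by have := nodes_pos tu; rewrite all_rcons => /andP[].
by apply: bigcup_finite => // u _; exact/finite_image/finite_II.
Qed.

Lemma finite_below (t : mtree) (n : nat) : finite_set (below t n).
Proof.
apply: (@sub_finite_set _ _ (\bigcup_(i in `I_n) level t i)).
  by move=> u [tu un]; exists (size u).
by apply: bigcup_finite => [|i _]; [exact: finite_II|exact: finite_level].
Qed.

(* Z_n and M_n; [fset_set A] enumerates A when A is finite, which holds here by
   the two lemmas above. *)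
Definition Zn (n : nat) (t : mtree) : nat := #|` fset_set (level t n)|.

Definition Mn (n : nat) (t : mtree) : nat :=
  (\sum_(u <- fset_set (below t n)) eta t u)%N.

Section restriction.
Variables (n : nat) (t : mtree).

Let rnodes : set (seq nat) := [set u | nodes t u /\ (size u <= n)%N].
Let rmarked : set (seq nat) := [set u | marked t u /\ (size u < n)%N].

Fact restr_pos u : rnodes u -> all (leq 1) u.
Proof. by case=> /nodes_pos. Qed.

Fact restr_root : rnodes [::].
Proof. by split => //; exact: nodes_root. Qed.

Fact restr_parent u j : rnodes (rcons u j) -> rnodes u.
Proof.
by case=> /nodes_parent tu; rewrite size_rcons => un; split => //; exact: ltnW.
Qed.

Fact restr_children u : rnodes u ->
  exists k : nat, forall i, (0 < i)%N -> rnodes (rcons u i) <-> (i <= k)%N.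
Proof.
case=> tu _; have [un|nu] := ltnP (size u) n.
  exists (nchild t u) => i i0; rewrite -nchildP //.
  by split => [[]//|tui]; split => //; rewrite size_rcons.
exists 0%N => -[//|i] _; split => // -[_].
by rewrite size_rcons ltnNge nu.
Qed.

Fact restr_marked : rmarked `<=` rnodes.
Proof. by move=> u [/marked_nodes tu un]; split => //; exact: ltnW. Qed.

Definition restr : mtree :=
  MTree restr_pos restr_root restr_parent restr_children restr_marked.

End restriction.

Fact root_children (u : seq nat) : [set [::]] u ->
  exists k : nat, forall i, (0 < i)%N -> [set [::]] (rcons u i) <-> (i <= k)%N.
Proof. by move=> /= ->; exists 0%N => -[]. Qed.

Fact root_parent (u : seq nat) j : [set [::]] (rcons u j) -> [set [::]] u.
Proof. by case: u. Qed.

Fact root_pos (u : seq nat) : [set [::]] u -> all (leq 1) u.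
Proof. by move=> /= ->. Qed.

Definition root_mtree : mtree :=
  @MTree [set [::]] set0 root_pos erefl root_parent root_children
    (@sub0set _ _).

HB.instance Definition _ := gen_eqMixin mtree.
HB.instance Definition _ := gen_choiceMixin mtree.
HB.instance Definition _ := isPointed.Build mtree root_mtree.

(* The sigma-field generated by the map r_n^*, whose range is countable and
   carries the discrete sigma-field. *)
Definition Fn (n : nat) : set (set mtree) :=
  preimage_set_system [set: mtree] (restr n) [set: set mtree].

(* The measurable space (T^*, F). *)
Notation mtreeF := (g_sigma_algebraType (\bigcup_n Fn n)).

Section galton_watson.
Variable R : realType.
Implicit Types (p q : nat -> R).

Definition offspring_distribution p :=
  (forall k, 0 <= p k) /\ (\sum_(0 <= k <oo) (p k)%:E = 1)%E.

Definition finite_mean p := (\sum_(0 <= k <oo) (k%:R * p k)%:E < +oo)%E.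

Definition mark_function q := forall k, 0 <= q k <= 1.

Definition p0 p q (k : nat) (e : bool) : R :=
  p k * (if e then q k else 1 - q k).

Definition marked_GW p q (P : probability mtreeF R) :=
  forall (h : nat) (t : mtree), (0 < h)%N ->
    P [set x | restr h x = restr h t] =
      (\prod_(u <- fset_set (below t h)) p0 p q (nchild t u) (eta t u))%:E.

Definition fgen (P : probability mtreeF R) (s t : R) : R :=
  fine 'E_P[(fun x : mtreeF => s ^+ Mn 1 x * t ^+ Zn 1 x)%R]%E.

(* The offspring-and-mark laws of normal and special nodes; m is f_s'(kappa).
   The exponent k - 1 is an integer, equal to -1 when k = 0. *)
Definition p_normal p q (s kappa : R) (k : nat) (e : bool) : R :=
  p0 p q k e * s ^+ e * kappa ^ (k%:Z - 1).

Definition p_special p q (s kappa m : R) (k : nat) (e : bool) : R :=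
  p_normal p q s kappa k e * k%:R / m.

Section special_tree.
Context d (W : measurableType d) (Pr : probability W R).
Variables (T : {RV Pr >-> mtreeF}) (V : nat -> W -> seq nat).

(* The tree up to generation n is that of t, and the special nodes of
   generations 0, ..., m are v 0, ..., v m. *)
Definition history (n m : nat) (t : mtree) (v : nat -> seq nat) : set W :=
  [set w | restr n (T w) = restr n t /\ forall j, (j <= m)%N -> V j w = v j].

(* V n is the special node of generation n (so V 0 is the root). As the tree up to a given
   generation and the special nodes are discrete, the conditional laws are
   given by elementary conditional probabilities, written
   Pr (A & B) = Pr A * Pr (B | A). *)
Definition special_tree (pn ps : nat -> bool -> R) :=
  [/\ (forall n u, measurable (V n @^-1` [set u])),
      (forall n, \forall w \ae Pr, level (T w) n (V n w)),
      (forall n t v, level t n (v n) ->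
        Pr (history n.+1 n t v) =
          Pr (history n n t v) *
          (ps (nchild t (v n)) (eta t (v n)) *
           \prod_(u <- fset_set (level t n) | u != v n)
              pn (nchild t u) (eta t u))%:E)%E
    & (forall n t v, level t n.+1 (v n.+1) ->
        Pr (history n.+1 n.+1 t v) =
          Pr (history n.+1 n t v) * ((Zn n.+1 t)%:R^-1)%:E)%E].

End special_tree.

(* The defining formula of Q_{s,2}; again m is f_s'(kappa). *)
Definition Qs2_formula (P : probability mtreeF R) (s kappa m : R)
    (Q : probability mtreeF R) :=
  forall (n : nat) (L : set mtreeF), Fn n L ->
    Q L = 'E_P[(fun x : mtreeF => \1_L x *
      (s ^+ Mn n x * (Zn n x)%:R * kappa ^ ((Zn n x)%:Z - 1) / m ^+ n))%R]%E.

End galton_watson.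

(* Main.v *)
Require Import Defs.
From HB Require Import structures.
From mathcomp Require Import all_boot all_order all_algebra.
From mathcomp Require Import finmap ring lra.
From mathcomp Require Import all_classical all_reals all_analysis.
From mathcomp Require Import measurable_realfun.

Import Order.TTheory GRing.Theory Num.Theory.
Import numFieldNormedType.Exports.

Set Implicit Arguments.
Unset Strict Implicit.
Unset Printing Implicit Defensive.

Local Open Scope classical_set_scope.
Local Open Scope ring_scope.

(* The restriction r_n takes countably many values, so a law on F is determined
   by the atoms {r_n = r_n t}. Let D_n = s^M_n Z_n kappa^(Z_n - 1) / m^n. Summing
   over the special node of generation n, uniform given r_n, the factors k / m
   of the special offspring law add up to Z_(n+1) / (m Z_n); hence every special
   tree satisfies Pr(r_n T = r_n t) = (Z_n / m^n) prod_(|u| < n) p_(s,0), and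
   sum_(|u| < n) (k_u - 1) = Z_n - 1 turns this into D_n(t) P(r_n = r_n t). The
   measure Q is then the law of a special tree built from an independent family
   with one normal and one special type for each word u, and one uniform choice
   for each possible generation (n, L). Its marginals are probability laws
   because f_s(kappa) = kappa and m = f_s'(kappa), with 0 < kappa < 1. *)

(** Two obstacles shape the proof. The special node of generation n is drawn from a level that
    depends on the earlier draws, so no single variable with a fixed law can be attached to n alone;
    one variable is prepared for each possible level [L], and the one consulted is that of the
    actual level. Likewise the spine selects which of the two types of a word is read. A history of
    the tree and of its special nodes then fixes in advance the finitely many variables that it
    constrains, and its probability is a product. The clauses that define a special tree, on the
    other hand, condition on all earlier special nodes, and these must be summed out before the
    recursion on r_n closes.

    The hypotheses on p and q enter through kappa and m: p(0) > 0 gives kappa > 0, so that a leaf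
    may contribute kappa^(-1); a mark of positive probability gives kappa < 1, so that f_s is
    differentiated term by term at an interior point; p(0) + p(1) < 1 gives m > 0. *)

Local Notation eta := Defs.eta.

(** * Discrete random variables *)

Section countable_sums.
Context (R : realType) (E : countType).
Local Open Scope ereal_scope.

(** Numbers that code no element contribute 0, so results on series, such as linearity, transfer to
    sums over a countable type. *)
Lemma esum_pickle (a : E -> \bar R) : (forall e, 0 <= a e) ->
  \esum_(e in [set: E]) a e = \sum_(n <oo) oapp a 0 (pickle_inv n).
Proof.
move=> a0; rewrite nneseries_esumT; last by move=> n; case: pickle_inv.
rewrite [RHS](esumID [set n | pickle_inv (T := E) n]); last first.
  by move=> n _; case: pickle_inv.
rewrite [X in _ = _ + X]esum1 ?adde0; last first.
  by move=> n [_ /=]; case: pickle_inv => //= x /(_ isT).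
rewrite setTI (reindex_esum setT _ (@choice.pickle E)); last first.
  split => [e _ /=|e f _ _ /(pcan_inj choice.pickleK)//|n /=].
    by rewrite pickleK_inv.
  by have := @pickle_invK E n; case: pickle_inv => //= e <- _; exists e.
by apply: eq_esum => e _; rewrite pickleK_inv.
Qed.

Lemma esumZl (r : R) (a : E -> \bar R) : (0 <= r)%R -> (forall e, 0 <= a e) ->
  \esum_(e in [set: E]) (r%:E * a e) = r%:E * \esum_(e in [set: E]) a e.
Proof.
move=> r0 a0; rewrite !esum_pickle//; last by move=> e; rewrite mule_ge0.
rewrite -nneseriesZl//; last by move=> n _; case: pickle_inv.
by apply: eq_eseriesr => n _; case: pickle_inv => //=; rewrite mule0.
Qed.

End countable_sums.

Section discrete_map.
Context d (T : measurableType d) (R : realType) (E : countType).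
Variable X : T -> E.
Hypothesis mX : forall e, measurable (X @^-1` [set e]).

(** [E] carries no sigma-field: measurability of the fibres plays the part of measurability of [X],
    because every preimage is a countable union of fibres. *)
Lemma measurable_preimage_fibers A : measurable (X @^-1` A).
Proof.
rewrite (_ : X @^-1` A =
    \bigcup_(n in [set n | oapp (mem A) false (pickle_inv n)])
      oapp (fun e => X @^-1` [set e]) set0 (pickle_inv n)).
  by apply: bigcup_measurable => n _; case: pickle_inv => /=.
apply/seteqP; split => [x Ax|x [n]] /=; last first.
  by case: pickle_inv => //= e /[!inE] Ae ->.
by exists (choice.pickle (X x)) => /=; rewrite pickleK_inv //= inE.
Qed.

Local Open Scope ereal_scope.
Variable mu : {measure set T -> \bar R}.

Lemma ge0_integral_fibers (D : set T) (f : T -> \bar R) : measurable D ->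
  measurable_fun D f -> (forall x, D x -> 0 <= f x) ->
  \int[mu]_(x in D) f x =
    \esum_(e in [set: E]) \int[mu]_(x in D `&` X @^-1` [set e]) f x.
Proof.
move=> mD mf f0; rewrite esum_pickle; last first.
  by move=> e; apply: integral_ge0 => x [Dx _]; exact: f0.
pose F n := D `&` [set x | choice.pickle (X x) = n].
have DF : D = \bigcup_n F n.
  by apply/seteqP; split => [x Dx|x [n _ []//]]; exists (choice.pickle (X x)).
have mF n : measurable (F n).
  apply: measurableI => //.
  exact: (measurable_preimage_fibers [set e | choice.pickle e = n]).
rewrite {1}DF ge0_integral_bigcup -?DF//; last first.
  by apply/trivIsetP => i j _ _ ij; rewrite -subset0 => x [[_ /= xi]] [_ /= xj];
    move: ij; rewrite -xi -xj eqxx.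
apply: eq_eseriesr => n _; rewrite /F; have := @pickle_invK E n.
case nE : (pickle_inv n) => [e|] /= en; last first.
  rewrite (_ : _ `&` _ = set0) ?integral_set0// -subset0 => x [_ /= xn].
  by move: nE; rewrite -xn pickleK_inv.
congr integral; apply/seteqP; split => x [Dx /=]; rewrite -{}en.
  by move/(pcan_inj choice.pickleK).
by move=> ->.
Qed.

Lemma measure_fibers (D : set T) : measurable D ->
  mu D = \esum_(e in [set: E]) mu (D `&` X @^-1` [set e]).
Proof.
move=> mD; rewrite -[LHS]mul1e -integral_cst// ge0_integral_fibers//.
apply: eq_esum => e _; rewrite integral_cst ?mul1e//; exact: measurableI.
Qed.

Lemma ge0_integral_comp_fibers (h : E -> \bar R) : (forall e, 0 <= h e) ->
  \int[mu]_x h (X x) = \esum_(e in [set: E]) (h e * mu (X @^-1` [set e])).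
Proof.
move=> h0; rewrite ge0_integral_fibers//; last first.
  by move=> _ Y mY; rewrite setTI; exact: (measurable_preimage_fibers (h @^-1` Y)).
apply: eq_esum => e _; rewrite setTI -integral_cst//.
by apply: eq_integral => x /[!inE] /= ->.
Qed.

End discrete_map.

(** * Independent families of discrete random variables *)

Section unit_probability.
Variable R : realType.

(** The underlying type is the whole line, so there are sample points outside [0, 1[; they form a
    null set and are handled by [clip]. *)
Definition unit_prob : set (measurableTypeR R) -> \bar R :=
  mrestr lebesgue_measure (measurable_itv `[0 : R, 1[).

HB.instance Definition _ := Measure.on unit_prob.

Let unit_probT : unit_prob setT = 1%E.
Proof.
by rewrite /unit_prob /mrestr setTI lebesgue_measure_itv /= lte_fin ltr01 sube0.
Qed.

HB.instance Definition _ :=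
  Measure_isProbability.Build _ _ _ unit_prob unit_probT.

End unit_probability.
Arguments unit_prob R : clear implicits.

(** * An independent sequence with given laws, read off the nested intervals containing a uniform
    point *)

Section nested_intervals.
Variables (R : realType) (nu : nat -> nat -> R).
Let W : measurableType _ := measurableTypeR R.
Hypothesis nu_ge0 : forall n k, 0 <= nu n k.
Hypothesis nu_sum : forall n, (\sum_(k <oo) (nu n k)%:E = 1)%E.

Let cum n k := \sum_(0 <= i < k) nu n i.

Let cumS n k : cum n k.+1 = cum n k + nu n k.
Proof. by rewrite /cum big_nat_recr. Qed.

Let cum_le n k l : (k <= l)%N -> cum n k <= cum n l.
Proof.
move=> /subnKC <-; elim: (l - k)%N => [|m IHm]; first by rewrite addn0.
by rewrite addnS cumS (le_trans IHm)// lerDl.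
Qed.

Let cum_le1 n k : cum n k <= 1.
Proof.
rewrite -lee_fin -(nu_sum n) /cum -sumEFin; apply: nneseries_lim_ge => i _ _.
by rewrite lee_fin.
Qed.

Let cum_gt n x : x < 1 -> exists k, x < cum n k.
Proof.
move=> x1; apply: contrapT => /forallNP cumx.
suff : (\sum_(k <oo) (nu n k)%:E <= x%:E)%E by rewrite nu_sum lee_fin leNgt x1.
apply: lime_le; first by apply: is_cvg_nneseries => k _ _; rewrite lee_fin.
by apply: nearW => k; rewrite sumEFin lee_fin leNgt; exact/negP/cumx.
Qed.

(* Left end and length of the interval of the outcomes, most recent first. *)
Fixpoint cell (h : seq nat) : R * R :=
  if h is k :: h' then
    ((cell h').1 + (cell h').2 * cum (size h') k,
     (cell h').2 * nu (size h') k)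
  else (0, 1).

Definition cell_itv h : set W := [set` `[(cell h).1, (cell h).1 + (cell h).2[].

Let cell_ge0 h : 0 <= (cell h).2.
Proof. by elim: h => //= k h IHh; rewrite mulr_ge0. Qed.

Let cell_itvP h w :
  cell_itv h w <-> (cell h).1 <= w < (cell h).1 + (cell h).2.
Proof. by rewrite /cell_itv /= in_itv. Qed.

Let cell_gt0 h w : cell_itv h w -> 0 < (cell h).2.
Proof. by move=> /cell_itvP /andP[/le_lt_trans] /[apply]; rewrite ltrDl. Qed.

Let cell_consP k h w : cell_itv (k :: h) w <->
  (cell h).1 + (cell h).2 * cum (size h) k <= w <
    (cell h).1 + (cell h).2 * cum (size h) k.+1.
Proof. by rewrite cell_itvP /= cumS mulrDr addrA. Qed.

Let cell_cons k h w : cell_itv (k :: h) w -> cell_itv h w.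
Proof.
move=> /cell_consP/andP[lw wu]; apply/cell_itvP; apply/andP; split.
  by rewrite (le_trans _ lw)// lerDl mulr_ge0// sumr_ge0.
by rewrite (lt_le_trans wu)// lerD2l ler_piMr.
Qed.

Let cell_inj k l h w : cell_itv (k :: h) w -> cell_itv (l :: h) w -> k = l.
Proof.
wlog kl : k l / (k <= l)%N => [H hk hl|].
  by case/orP: (leq_total k l) => ?; [exact: H|exact/esym/H].
move=> hk /cell_consP/andP[lw _]; move: hk => /cell_consP/andP[_ wk].
apply/eqP; rewrite eqn_leq kl leqNgt; apply/negP => lk.
have : (cell h).1 + (cell h).2 * cum (size h) k.+1 <= w.
  by rewrite (le_trans _ lw)// lerD2l ler_wpM2l// cum_le.
by rewrite leNgt wk.
Qed.

Let cell_ex h w : cell_itv h w -> exists k, cell_itv (k :: h) w.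
Proof.
move=> hw; have d0 := cell_gt0 hw; move: hw => /cell_itvP/andP[lw wu].
have [|k] := @cum_gt (size h) ((w - (cell h).1) / (cell h).2).
  by rewrite ltr_pdivrMr// mul1r ltrBlDl.
rewrite ltr_pdivrMr// mulrC ltrBlDl => wk.
have exk : exists k, w < (cell h).1 + (cell h).2 * cum (size h) k by exists k.
(* The least such index is not 0, whose end point is the left end of the cell of [h]; its
   predecessor is the outcome at [w]. *)
case: (ex_minnP exk) => -[|m]; first by rewrite /cum big_nil mulr0 addr0 ltNge lw.
move=> wm minm; exists m; apply/cell_consP; rewrite wm andbT leNgt.
by apply/negP => /minm; rewrite ltnn.
Qed.

(** Sending stray points to 0 gives every sample point an outcome at every step, so later statements
    hold everywhere and not just almost surely. *)
Let clip (w : W) : W := if w \in `[0, 1[ then w else 0.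

Let cell_clip w : cell_itv [::] (clip w).
Proof.
apply/cell_itvP; rewrite /= add0r /clip; case: ifPn; first by rewrite in_itv.
by rewrite lexx ltr01.
Qed.

Let next (h : seq nat) (w : W) : nat := get [set k | cell_itv (k :: h) (clip w)].

Let hist n (w : W) := iter n (fun h => next h w :: h) [::].

Let size_hist n w : size (hist n w) = n.
Proof. by elim: n => //= n ->. Qed.

Let cell_next h w : cell_itv h (clip w) -> cell_itv (next h w :: h) (clip w).
Proof. by move=> /cell_ex hw; exact: (xgetPex 0%N hw). Qed.

Let cell_hist n w : cell_itv (hist n w) (clip w).
Proof. by elim: n => [|n IHn]; [exact: cell_clip|exact: cell_next]. Qed.

Let histP h w : hist (size h) w = h <-> cell_itv h (clip w).
Proof.
split=> [hw|]; first by have := cell_hist (size h) w; rewrite hw.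
elim: h => //= k h IHh hw; have hw' := cell_cons hw; have -> := IHh hw'.
by congr cons; apply: cell_inj (cell_next hw') hw.
Qed.

Definition nested_rv n (w : W) : nat := next (hist n w) w.

Let X := nested_rv.
Let Pr : probability W R := unit_prob R.

Let histS n w : hist n.+1 w = X n w :: hist n w. Proof. by []. Qed.

Let hist_fiber n h : hist n @^-1` [set h] =
  if size h == n then [set w | cell_itv h (clip w)] else set0.
Proof.
apply/seteqP; split => w /=.
  by move=> <-; rewrite size_hist eqxx; exact: cell_hist.
by case: eqP => // <- /histP.
Qed.

Let cell_sub01 h : cell_itv h `<=` [set` `[0, 1[].
Proof.
elim: h => [w /cell_itvP /=|k h IHh w /cell_cons/IHh//].
by rewrite in_itv /= add0r.
Qed.

Let clipE w : w \in `[0, 1[ -> clip w = w.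
Proof. by rewrite /clip /= => ->. Qed.

Let measurable_cell h : measurable [set w | cell_itv h (clip w)].
Proof.
(* Off [0, 1[ the event is all or nothing, according to whether 0 lies in the cell. *)
rewrite (_ : mkset _ = cell_itv h `|` (~` [set` `[0, 1[] `&` [set _ | cell_itv h 0])).
  apply: measurableU; first exact: measurable_itv.
  apply: measurableI; first by apply: measurableC; exact: measurable_itv.
  have [h0|h0] := pselect (cell_itv h 0).
    by rewrite (_ : mkset _ = setT)//; apply/seteqP; split.
  by rewrite (_ : mkset _ = set0)//; apply/seteqP; split.
apply/seteqP; split => w /=.
  have [w01|w01] := boolP (w \in `[0, 1[); first by rewrite clipE//; left.
  by rewrite /clip (negbTE w01) => h0; right; split => //; exact/negP.
move=> [hw|[/negP w01]]; first by rewrite clipE//; exact: cell_sub01 hw.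
by rewrite /clip (negbTE w01).
Qed.

Let Pr_cell h : Pr [set w | cell_itv h (clip w)] = (cell h).2%:E.
Proof.
rewrite /Pr /= /unit_prob /mrestr (_ : _ `&` _ = cell_itv h); last first.
  apply/seteqP; split => w /= [].
    by move=> /[swap] w01; rewrite clipE.
  by move=> hw; have w01 := cell_sub01 hw; rewrite clipE.
rewrite /cell_itv lebesgue_measure_itv /= lte_fin ltrDl.
have [->|d0] := eqVneq (cell h).2 0; first by rewrite ltxx.
by rewrite lt_neqAle eq_sym d0 cell_ge0 -EFinB addrAC subrr add0r.
Qed.

Let measurable_hist n h : measurable (hist n @^-1` [set h]).
Proof. by rewrite hist_fiber; case: ifP. Qed.

Lemma measurable_nested_rv n A : measurable (nested_rv n @^-1` A).
Proof.
rewrite (_ : _ @^-1` _ = hist n.+1 @^-1` (head 0%N @^-1` A))//.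
by apply: measurable_preimage_fibers; exact: measurable_hist.
Qed.

(** A half-open interval that contains a point has positive length. The bound holds at every [w],
    which lets the tree be built without discarding null sets. *)
Lemma nested_rv_gt0 n w : 0 < nu n (nested_rv n w).
Proof.
have := cell_gt0 (cell_hist n.+1 w); rewrite histS /= size_hist.
by rewrite pmulr_rgt0//; exact: cell_gt0 (cell_hist n w).
Qed.

(** [S] marks the constrained coordinates among the [m] that follow the history [h]. Induction on
    [m] for all [h]: a constrained coordinate lengthens the history by the prescribed outcome, a
    free one is summed out and has total mass 1. *)
Let Pr_history (S : pred nat) (a : nat -> nat) m h :
  Pr (hist (size h) @^-1` [set h] `&`
      [set w | forall i, (size h <= i < size h + m)%N -> S i -> X i w = a i]) =
  ((cell h).2 * \prod_(size h <= i < size h + m | S i) nu i (a i))%:E.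
Proof.
elim: m h => [|m IHm] h.
  rewrite addn0 big_geq// mulr1 -Pr_cell hist_fiber eqxx; congr (Pr _).
  apply/seteqP; split => w /= => [[]//|hw]; split => // i.
  by rewrite leqNgt andNb.
have E k w : X (size h) w = k -> hist (size h) w = h ->
  hist (size h).+1 w = k :: h by move=> wk hw; rewrite histS wk hw.
set G := (X in Pr X).
have mG : measurable G.
  apply: measurableI => //.
  rewrite (_ : mkset _ = \bigcap_(i in [set i | (size h <= i < size h + m.+1)%N /\ S i])
     X i @^-1` [set a i]); last first.
    by apply/seteqP; split=> w /= Hw => [i [hi Si]|i hi Si]; apply: Hw.
  by apply: bigcap_measurableType => i _; exact: measurable_nested_rv.
have GE k : (S (size h) -> k = a (size h)) -> G `&` X (size h) @^-1` [set k] =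
   hist (size (k :: h)) @^-1` [set k :: h] `&`
      [set w | forall i, (size (k :: h) <= i < size (k :: h) + m)%N ->
         S i -> X i w = a i].
  move=> Sk; apply/seteqP; split => w.
    move=> [[/= hw Hw] wk]; split; first exact: E.
    by move=> i; rewrite addSnnS => /andP[hi im]; apply: Hw; rewrite im ltnW.
  move=> [+ Hw]; rewrite -[X in X -> _]/(X (size h) w :: hist (size h) w = k :: h).
  move=> -[wk hw]; split => //; split => //= i.
  rewrite -addSnnS => /andP[]; rewrite leq_eqVlt => /predU1P[<- _ Si|hi im].
    by rewrite wk Sk.
  by apply: Hw; rewrite hi.
rewrite big_ltn_cond ?addnS ?ltnS ?leq_addr// -addSn.
case: ifPn => Sh.
  transitivity (Pr (G `&` X (size h) @^-1` [set a (size h)])).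
    congr (Pr _); apply/seteqP; split => w; last by case.
    move=> [hw Hw]; split => //; apply: Hw => //.
    by rewrite leqnn addnS ltnS leq_addr.
  by rewrite GE// IHm /= mulrA.
have mX k : measurable (X (size h) @^-1` [set k]) by exact: measurable_nested_rv.
transitivity (\esum_(k in [set: nat]) Pr (G `&` X (size h) @^-1` [set k])).
  exact: (measure_fibers mX Pr mG).
transitivity (\esum_(k in [set: nat]) (((cell h).2 *
    \prod_((size h).+1 <= i < (size h).+1 + m | S i) nu i (a i))%:E *
    (nu (size h) k)%:E))%E.
  by apply: eq_esum => k _; rewrite GE ?(negbTE Sh)// IHm /= -EFinM mulrAC.
rewrite esumZl; last by move=> k; rewrite lee_fin.
  by rewrite -nneseries_esumT ?nu_sum ?mule1// => k; rewrite lee_fin.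
by rewrite mulr_ge0// prodr_ge0.
Qed.

Lemma nested_rv_independent (s : seq nat) (a : nat -> nat) : uniq s ->
  unit_prob R [set w | forall i, i \in s -> nested_rv i w = a i] =
  (\prod_(i <- s) nu i (a i))%:E.
Proof.
move=> us; set m := (\max_(i <- s) i).+1.
have sm i : i \in s -> (i < m)%N by move=> si; rewrite ltnS; apply: leq_bigmax_seq.
have := Pr_history (mem s) a m [::]; rewrite /= mul1r add0n => E.
transitivity ((\prod_(0 <= i < m | i \in s) nu i (a i))%:E).
  rewrite -E; congr (Pr _); apply/seteqP; split => w /=.
    by move=> Hw; split => // i _; exact: Hw.
  by move=> [_ Hw] i si; apply: Hw => //; exact: sm.
congr EFin; rewrite -big_filter; apply: perm_big.
apply: uniq_perm => //; first by rewrite filter_uniq// iota_uniq.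
move=> i; rewrite mem_filter mem_index_iota /=.
by case: (boolP (i \in s)) => //= /sm ->.
Qed.

End nested_intervals.

Lemma independent_family (R : realType) (I E : countType) (mu : I -> E -> R) :
  (forall i e, 0 <= mu i e) ->
  (forall i, \esum_(e in [set: E]) (mu i e)%:E = 1)%E ->
  exists (d : measure_display) (W : measurableType d) (Pr : probability W R)
    (X : I -> W -> E),
    [/\ (forall i e, measurable (X i @^-1` [set e])),
        (forall i w, 0 < mu i (X i w)) &
        (forall (s : seq I) (a : I -> E), uniq s ->
          Pr [set w | forall i, i \in s -> X i w = a i] =
          (\prod_(i <- s) mu i (a i))%:E)].
Proof.
move=> mu0 mu1.
(* A number that codes no index gets the point mass at 0, so that every coordinate has a probability
   law. *)
pose nu (n k : nat) : R := if pickle_inv n is Some i then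
  oapp (mu i) 0 (pickle_inv k) else (k == 0%N)%:R.
have nu0 n k : 0 <= nu n k.
  by rewrite /nu; case: pickle_inv => [i|]; [case: pickle_inv => /=|case: eqP].
have nu1 n : (\sum_(k <oo) (nu n k)%:E = 1)%E.
  rewrite /nu; case: pickle_inv => [i|].
    rewrite -(mu1 i) esum_pickle => [|e]; last by rewrite lee_fin.
    by apply: eq_eseriesr => k _; case: pickle_inv.
  rewrite nneseries_recl//.
  by rewrite eseries0 ?adde0//= => -[].
exists _, (measurableTypeR R), (unit_prob R).
(* Positivity of the mass at every point forces each outcome to be the code of an element of [E]. *)
have exX (i : I) w : exists e : E, choice.pickle e = nested_rv nu (choice.pickle i) w.
  have := nested_rv_gt0 nu0 nu1 (choice.pickle i) w.
  set n := nested_rv _ _ _; rewrite /nu pickleK_inv.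
  have := @pickle_invK E n.
  by case: pickle_inv => /= [e <- _|]; [exists e|rewrite ltxx].
have [X XP'] := choice (fun iw : I * R => exX iw.1 iw.2).
have XP i w := XP' (i, w).
exists (fun i w => X (i, w)); split.
- move=> i e; rewrite (_ : _ @^-1` _ =
    nested_rv nu (choice.pickle i) @^-1` [set choice.pickle e]).
    exact: measurable_nested_rv.
  apply/seteqP; split => w /=; rewrite -XP; first by move=> ->.
  exact: (pcan_inj choice.pickleK).
- move=> i w; have := nested_rv_gt0 nu0 nu1 (choice.pickle i) w.
  by rewrite -XP /nu !pickleK_inv.
- move=> s a us.
  pose b n := if pickle_inv n is Some i then choice.pickle (a i) else 0%N.
  have := @nested_rv_independent _ _ nu0 nu1 (map choice.pickle s) b.
  rewrite map_inj_uniq; last exact: (pcan_inj choice.pickleK).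
  move=> /(_ us); rewrite big_map; under eq_bigr do rewrite /nu /b !pickleK_inv /=.
  move=> <-; congr (unit_prob R _); apply/seteqP; split => w /= Hw.
    by move=> _ /mapP[i si ->]; rewrite -XP /b pickleK_inv Hw.
  move=> i si; have := Hw _ (map_f _ si); rewrite -XP /b pickleK_inv.
  exact: (pcan_inj choice.pickleK).
Qed.

(** * Marked trees *)

Lemma mtree_eq (t t' : mtree) :
  nodes t = nodes t' -> marked t = marked t' -> t = t'.
Proof.
case: t t' => [N M ? ? ? ? ?] [N' M' ? ? ? ? ?] /= NN MM; subst N' M'.
by congr MTree; exact: Prop_irrelevance.
Qed.

Definition node_type (t : mtree) (u : seq nat) : nat * bool :=
  (nchild t u, eta t u).

Lemma nchild_eq (t : mtree) (u : seq nat) (k : nat) : nodes t u ->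
  (forall i, (0 < i)%N -> nodes t (rcons u i) <-> (i <= k)%N) -> nchild t u = k.
Proof.
move=> tu tk; have cmp i : (0 < i)%N -> (i <= nchild t u)%N = (i <= k)%N.
  by move=> i0; apply/idP/idP => [/(nchildP tu i0)/(tk _ i0)//|
    /(tk _ i0)/(nchildP tu i0)].
apply/eqP; rewrite eqn_leq; apply/andP; split.
  by case E : (nchild t u) => [//|m]; rewrite -cmp// E.
by case E : k => [//|m]; rewrite cmp// E.
Qed.

Section restriction_lemmas.
Implicit Types (t : mtree) (u : seq nat) (n k : nat).

Lemma restr_nodes n t t' u : restr n t = restr n t' -> (size u <= n)%N ->
  nodes t u <-> nodes t' u.
Proof.
move=> tt' un; have /= E := congr1 (fun x => nodes x u) tt'.
split=> h.
  by have : nodes t u /\ (size u <= n)%N by []; rewrite E => -[].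
by have : nodes t' u /\ (size u <= n)%N by []; rewrite -E => -[].
Qed.

Lemma restr_marked n t t' u : restr n t = restr n t' -> (size u < n)%N ->
  marked t u <-> marked t' u.
Proof.
move=> tt' un; have /= E := congr1 (fun x => marked x u) tt'.
split=> h.
  by have : marked t u /\ (size u < n)%N by []; rewrite E => -[].
by have : marked t' u /\ (size u < n)%N by []; rewrite -E => -[].
Qed.

Lemma restr_node_type n t t' u : restr n t = restr n t' -> below t n u ->
  node_type t u = node_type t' u.
Proof.
move=> tt' [tu un]; congr pair; last first.
  by apply: asbool_equiv_eq; exact: restr_marked tt' un.
have t'u : nodes t' u by apply/(restr_nodes tt') => //; exact: ltnW.
apply: nchild_eq => // i i0; rewrite -(nchildP t'u)//.
by apply: restr_nodes tt' _; rewrite size_rcons.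
Qed.

(** Only common nodes need comparing: by induction on words, the type of a common node decides which
    of its children are nodes, so the two trees cannot diverge before level [n]. *)
Lemma eq_restr n t t' :
  (forall u, below t n u -> below t' n u -> node_type t u = node_type t' u) ->
  restr n t = restr n t'.
Proof.
move=> tt'.
have N u : (size u <= n)%N -> nodes t u <-> nodes t' u.
  elim/last_ind: u => [_|u j IHu]; first by split=> _; exact: nodes_root.
  rewrite size_rcons => un; have [uu' u'u] := IHu (ltnW un).
  suff H : nodes t u -> nodes t (rcons u j) <-> nodes t' (rcons u j).
    split=> h; first by apply/(H (nodes_parent h)).
    by apply/(H (u'u (nodes_parent h))).
  move=> tu; have t'u := uu' tu.
  have [E _] := tt' u (conj tu un) (conj t'u un).
  (* The letter 0 occurs in no node. *)
  case: j => [|j]; last by rewrite (nchildP tu)// (nchildP t'u)// E.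
  by split=> /nodes_pos; rewrite all_rcons.
apply: mtree_eq; apply/seteqP; split => u /= [tu un]; split => //.
- exact/N.
- exact/N.
- have tn := marked_nodes tu; have t'n := (N u (ltnW un)).1 tn.
  have [_] := tt' u (conj tn un) (conj t'n un).
  by rewrite /eta (mem_set tu) => /esym/set_mem.
- have t'n := marked_nodes tu; have tn := (N u (ltnW un)).2 t'n.
  have [_] := tt' u (conj tn un) (conj t'n un).
  by rewrite /eta (mem_set tu) => /set_mem.
Qed.

Lemma restr_le n k t t' : (k <= n)%N -> restr n t = restr n t' ->
  restr k t = restr k t'.
Proof.
move=> kn tt'; apply: eq_restr => u [tu uk] _; apply: restr_node_type tt' _.
by split => //; exact: leq_trans kn.
Qed.

Lemma restr_level n k t t' : (k <= n)%N -> restr n t = restr n t' ->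
  level t k = level t' k.
Proof.
by move=> kn tt'; apply/seteqP; split=> u [tu uk]; split => //;
  apply/(restr_nodes tt'); rewrite ?uk.
Qed.

Lemma restr_below n k t t' : (k <= n.+1)%N -> restr n t = restr n t' ->
  below t k = below t' k.
Proof.
by move=> kn tt'; apply/seteqP; split=> u [tu uk]; split => //;
  apply/(restr_nodes tt') => //; rewrite -ltnS (leq_trans uk).
Qed.

Lemma restr_root t t' : restr 0 t = restr 0 t'.
Proof. by apply: eq_restr => u []. Qed.

(** A faithful encoding of [restr n t] in a countable type, which makes the lemmas on fibres
    applicable; [below] is strict, hence [n.+1] for the nodes and [n] for the marks. *)
Definition restr_code n t : {fset seq nat} * {fset seq nat} :=
  (fset_set (below t n.+1), fset_set (below t n `&` marked t)).

Lemma restr_codeP n t t' :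
  restr_code n t = restr_code n t' <-> restr n t = restr n t'.
Proof.
split=> [[]|tt'].
  move=> /(congr1 (fun A : {fset seq nat} => [set` A])).
  rewrite !fset_setK; [|exact: finite_below..] => N.
  move=> /(congr1 (fun A : {fset seq nat} => [set` A])).
  rewrite !fset_setK; [|by apply: finite_setIl; exact: finite_below..] => M.
  apply: mtree_eq; first exact: N.
  have ME x : [set u | marked x u /\ (size u < n)%N] = below x n `&` marked x.
    by apply/seteqP; split => u /= [] => [xu|[xu]]; split => //; split => //;
      exact: marked_nodes.
  by rewrite /= !ME.
rewrite /restr_code; congr (fset_set _, fset_set _); first exact: restr_below tt'.
apply/seteqP; split => u [[tu un] mu]; split.
- by split => //; apply/(restr_nodes tt') => //; exact: ltnW.
- exact/(restr_marked tt' un).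
- by split => //; apply/(restr_nodes tt') => //; exact: ltnW.
- exact/(restr_marked tt' un).
Qed.

Lemma level0 t : level t 0 = [set [::]].
Proof.
by apply/seteqP; split => [u [_ /size0nil]//|u /= ->]; split => //; exact: nodes_root.
Qed.

Lemma below0 t : below t 0 = set0.
Proof. by apply/seteqP; split => u []. Qed.

Lemma Zn0 t : Zn 0 t = 1%N.
Proof. by rewrite /Zn level0 fset_set1 cardfs1. Qed.

Lemma Mn0 t : Mn 0 t = 0%N.
Proof. by rewrite /Mn below0 fset_set0 big_nil. Qed.

Lemma mem_level t n u : (u \in fset_set (level t n)) <-> level t n u.
Proof. by rewrite in_fset_set ?inE//; exact: finite_level. Qed.

Lemma mem_below t n u : (u \in fset_set (below t n)) <-> below t n u.
Proof. by rewrite in_fset_set ?inE//; exact: finite_below. Qed.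

Lemma perm_belowS t n :
  perm_eq (fset_set (below t n.+1))
    (fset_set (below t n) ++ fset_set (level t n)).
Proof.
apply: uniq_perm; rewrite ?cat_uniq ?fset_uniq// ?andbT.
  by apply/hasPn => u /mem_level[_ un]; apply/negP => /mem_below[_]; rewrite un ltnn.
move=> u; rewrite mem_cat; apply/idP/orP.
  move=> /mem_below[tu]; rewrite ltnS leq_eqVlt => /orP[/eqP un|un].
    by right; exact/mem_level.
  by left; exact/mem_below.
move=> [/mem_below[tu un]|/mem_level[tu un]]; apply/mem_below; split => //.
  exact: ltnW.
by rewrite un.
Qed.

Lemma big_belowS T (idx : T) (op : Monoid.com_law idx) (F : seq nat -> T) t n :
  \big[op/idx]_(u <- fset_set (below t n.+1)) F u =
  op (\big[op/idx]_(u <- fset_set (below t n)) F u)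
     (\big[op/idx]_(u <- fset_set (level t n)) F u).
Proof. by rewrite (perm_big _ (perm_belowS t n)) big_cat. Qed.

Lemma MnS t n :
  Mn n.+1 t = (Mn n t + \sum_(u <- fset_set (level t n)) eta t u)%N.
Proof. exact: big_belowS. Qed.

Lemma ZnS t n : Zn n.+1 t = (\sum_(u <- fset_set (level t n)) nchild t u)%N.
Proof.
(* Level [n.+1] listed parent by parent; [i.+1] because letters start at 1. *)
pose s := [seq rcons u i.+1 | u <- fset_set (level t n), i <- iota 0 (nchild t u)].
have -> : Zn n.+1 t = size s.
  apply: perm_size; apply: uniq_perm; first exact: fset_uniq.
    apply: allpairs_uniq_dep; [exact: fset_uniq|by move=> u _; exact: iota_uniq|].
    by move=> [u i] [v j] _ _ /= /rcons_inj[-> ->].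
  move=> u; apply/idP/idP => [/mem_level[]|].
    case/lastP: u => // u [|j] tu; first by have := nodes_pos tu; rewrite all_rcons.
    rewrite size_rcons => -[un]; have tu' := nodes_parent tu.
    apply/allpairsPdep; exists u, j; split => //; first exact/mem_level.
    by rewrite mem_iota add0n; apply/(nchildP tu').
  move=> /allpairsPdep[v [j [/mem_level[tv vn]]]]; rewrite mem_iota add0n => jv ->.
  by apply/mem_level; split; [apply/(nchildP tv)|rewrite size_rcons vn].
rewrite size_allpairs_dep sumnE big_map.
by apply: eq_bigr => u _; rewrite size_iota.
Qed.

(** The sum telescopes, since level [n] adds Z_(n+1) - Z_n. It is taken in [int] because a leaf
    contributes -1. *)
Lemma sum_nchild_below t n :
  \sum_(u <- fset_set (below t n)) ((nchild t u)%:Z - 1) = (Zn n t)%:Z - 1.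
Proof.
elim: n => [|n IHn]; first by rewrite Zn0 below0 fset_set0 big_nil subrr.
rewrite big_belowS /= IHn sumrB ZnS big_const_seq count_predT.
rewrite (big_morph Posz PoszD (erefl _)).
have -> : iter (size (fset_set (level t n))) (+%R (1 : int)) 0 = (Zn n t)%:Z.
  by rewrite /Zn; elim: (size (fset_set (level t n))) => //= m ->; rewrite -PoszD.
by rewrite addrC addrA subrK.
Qed.

Lemma restr_Zn n k t t' : (k <= n)%N -> restr n t = restr n t' -> Zn k t = Zn k t'.
Proof. by move=> kn tt'; rewrite /Zn (restr_level kn tt'). Qed.

Lemma restr_Mn n t t' : restr n t = restr n t' -> Mn n t = Mn n t'.
Proof.
move=> tt'; rewrite /Mn -(restr_below (leqnSn n) tt') big_seq [RHS]big_seq.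
by apply: eq_bigr => u /mem_below /(restr_node_type tt')[_ ->].
Qed.

End restriction_lemmas.

(** * The tree generated by types prescribed on all words *)

Section tree_of_types.
Variable c : seq nat -> nat * bool.

Definition is_node (u : seq nat) : bool :=
  all (fun i => (0 < nth 0 u i <= (c (take i u)).1)%N) (iota 0 (size u)).

Lemma is_node_rcons u j :
  is_node (rcons u j) = is_node u && (0 < j <= (c u).1)%N.
Proof.
rewrite /is_node size_rcons -[(size u).+1]addn1 iotaD all_cat /= andbT add0n.
rewrite nth_rcons ltnn eqxx -cats1 take_cat ltnn subnn take0 cats0; congr andb.
apply: eq_in_all => i; rewrite mem_iota add0n => /= iu.
by rewrite nth_cat iu take_cat iu.
Qed.

Fact tree_of_pos u : is_node u -> all (leq 1) u.
Proof.
elim/last_ind: u => // u j IHu; rewrite is_node_rcons all_rcons.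
by move=> /andP[/IHu -> /andP[-> _]].
Qed.

Fact tree_of_parent u j : is_node (rcons u j) -> is_node u.
Proof. by rewrite is_node_rcons => /andP[]. Qed.

Fact tree_of_children u : is_node u ->
  exists k : nat, forall i, (0 < i)%N -> is_node (rcons u i) <-> (i <= k)%N.
Proof. by move=> cu; exists (c u).1 => i i0; rewrite is_node_rcons cu i0. Qed.

Definition tree_of : mtree :=
  @MTree is_node [set u | is_node u /\ (c u).2] tree_of_pos isT tree_of_parent
    tree_of_children (fun _ => @proj1 _ _).

Lemma node_type_tree_of u : nodes tree_of u -> node_type tree_of u = c u.
Proof.
move=> cu; rewrite [RHS]surjective_pairing; congr pair; last first.
  by apply/idP/idP => [/[!inE] -[]//|cu2]; rewrite inE; split.
by apply: nchild_eq => // i i0; rewrite /= is_node_rcons i0 (cu : is_node u).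
Qed.

(** Agreement with [t] up to level [n] becomes a finite set of conditions on [c], at words that
    depend on [t] alone: the form to which independence applies. *)
Lemma restr_tree_of n t : restr n tree_of = restr n t <->
  (forall u, below t n u -> c u = node_type t u).
Proof.
split=> [tt' u tu|ct]; last first.
  by apply: eq_restr => u [cu _] tu; rewrite node_type_tree_of// ct.
rewrite (restr_node_type (esym tt') tu) node_type_tree_of//.
by have [] : below tree_of n u by rewrite (restr_below (leqnSn n) tt').
Qed.

End tree_of_types.

(** * Laws of marked trees *)

Lemma FnP n (L : set mtree) :
  Fn n L <-> (forall x y, restr n x = restr n y -> L x -> L y).
Proof.
split=> [[B _ <-] x y xy [_ Bx]|HL]; first by split=> //=; rewrite -xy.
exists (restr n @` L) => //; rewrite setTI; apply/seteqP; split => x /=.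
  by move=> [y Ly yx]; exact: HL yx Ly.
by move=> Lx; exists x.
Qed.

Lemma measurable_Fn n (L : set mtreeF) : Fn n L -> measurable L.
Proof. by move=> FL; apply: sub_sigma_algebra; exists n. Qed.

Lemma Fn_restr n t : Fn n [set x | restr n x = restr n t].
Proof. by apply/FnP => x y xy /= <-. Qed.

Lemma measurable_restr_code n c :
  measurable ((restr_code n : mtreeF -> _) @^-1` [set c]).
Proof.
apply: (@measurable_Fn n); apply/FnP => x y /restr_codeP xy /=.
by rewrite -xy.
Qed.

Lemma setI_closed_Fn : setI_closed (\bigcup_n Fn n).
Proof.
move=> A B [n _ /FnP FA] [k _ /FnP FB]; exists (maxn n k) => //.
apply/FnP => x y xy [Ax Bx]; split.
  by apply: FA Ax; apply: restr_le xy; exact: leq_maxl.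
by apply: FB Bx; apply: restr_le xy; exact: leq_maxr.
Qed.

Section law_of_mtree.
Variable R : realType.
Implicit Types (p q : nat -> R) (P Q : probability mtreeF R).

Lemma mtree_law_unique (Q Q' : probability mtreeF R) :
  (forall n L, Fn n L -> Q L = Q' L) -> forall A, measurable A -> Q A = Q' A.
Proof.
move=> QQ' A mA; apply: (@measure_unique _ R mtreeF (\bigcup_n Fn n)
  (fun=> setT) _ _ _ _ Q Q' _ _ A mA) => //.
- exact: setI_closed_Fn.
- by move=> _; exists 0%N => //; apply/FnP.
- by rewrite bigcup_const//; exists 0%N.
- by move=> L [n _]; exact: QQ'.
- by move=> _; rewrite (le_lt_trans (probability_le1 _ _))// ltry.
Qed.

Lemma measure_Fn_restr (mu : {measure set mtreeF -> \bar R}) n (L : set mtreeF) :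
  Fn n L ->
  mu L = (\esum_(c in [set: _])
    mu (L `&` (restr_code n : mtreeF -> _) @^-1` [set c]))%E.
Proof.
move=> FL; apply: measure_fibers; first exact: measurable_restr_code.
exact: measurable_Fn FL.
Qed.

Definition Qs2_density (s kappa m : R) n (x : mtree) : R :=
  s ^+ Mn n x * (Zn n x)%:R * kappa ^ ((Zn n x)%:Z - 1) / m ^+ n.

(** The indicator of [L] and the density are constant on the countably many atoms of [restr n], so
    the expectation is a sum over atoms. *)
Lemma Qs2_formula_atoms P Q (s kappa m : R) :
  0 <= s -> 0 <= kappa -> 0 <= m ->
  (forall n t, Q [set x | restr n x = restr n t] =
     (Qs2_density s kappa m n t)%:E * P [set x | restr n x = restr n t])%E ->
  Qs2_formula P s kappa m Q.
Proof.
move=> s0 k0 m0 QP n L FL.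
have D0 x : 0 <= Qs2_density s kappa m n x.
  by rewrite !mulr_ge0 ?invr_ge0 ?exprn_ge0 ?ler0n ?exprz_ge0.
have DE x y : restr n x = restr n y ->
    Qs2_density s kappa m n x = Qs2_density s kappa m n y.
  by move=> xy; rewrite /Qs2_density (restr_Mn xy) (restr_Zn (leqnn n) xy).
have L1 x y : restr n x = restr n y -> \1_L x = \1_L y :> R.
  move=> xy; rewrite !indicE; congr (_%:R); congr nat_of_bool.
  apply/idP/idP; rewrite !inE; first by move: xy; exact: (FnP _ _).1.
  by move: (esym xy); exact: (FnP _ _).1.
rewrite unlock (ge0_integral_fibers (@measurable_restr_code n))//; last 2 first.
- move=> _ Y mY; rewrite setTI; apply: (@measurable_Fn n); apply/FnP => x y xy /=.
  rewrite -!/(Qs2_density _ _ _ _ _) (DE _ _ xy).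
  by rewrite (L1 _ _ xy).
- by move=> x _; rewrite lee_fin mulr_ge0//; exact: D0.
rewrite (measure_Fn_restr Q FL); apply: eq_esum => c _; rewrite setTI.
have [[t /= tc]|nc] := pselect (exists t, restr_code n t = c); last first.
  rewrite (_ : _ @^-1` _ = set0) ?setI0 ?integral_set0 ?measure0//.
  by apply/seteqP; split => // x xc; apply: nc; exists x.
have -> : (restr_code n : mtreeF -> _) @^-1` [set c] = [set x | restr n x = restr n t].
  by apply/seteqP; split => x /=; rewrite -tc => /restr_codeP.
have mt : measurable ([set x | restr n x = restr n t] : set mtreeF).
  exact: measurable_Fn (Fn_restr n t).
rewrite (eq_integral (fun=> (\1_L t * Qs2_density s kappa m n t)%:E)); last first.
  by move=> x /[!inE] /= xt; rewrite (L1 _ _ xt) -(DE _ _ xt).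
rewrite integral_cst// indicE; have [Lt|Lt] := boolP (t \in L).
  rewrite mul1r -QP; congr (Q _); apply/seteqP; split => x /=; first by case.
  move=> xt; split => //; apply: (FnP _ _).1 FL _ _ (esym xt) _.
  by rewrite inE in Lt.
rewrite mul0r mul0e (_ : L `&` _ = set0) ?measure0//.
apply/seteqP; split => x // [Lx /= xt]; move/negP: Lt; apply; rewrite inE.
exact: (FnP _ _).1 FL _ _ xt Lx.
Qed.

(** Since [kappa != 0], the exponents, negative ones included, add up, and [sum_nchild_below]
    evaluates their sum. *)
Lemma prod_p_normal p q (s kappa : R) n t : kappa != 0 ->
  \prod_(u <- fset_set (below t n)) p_normal p q s kappa (nchild t u) (eta t u) =
  \prod_(u <- fset_set (below t n)) p0 p q (nchild t u) (eta t u) *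
    s ^+ Mn n t * kappa ^ ((Zn n t)%:Z - 1).
Proof.
move=> k0; rewrite /p_normal !big_split /= prodrXr; congr (_ * _ * _).
rewrite -sum_nchild_below; apply/esym.
by apply: (big_morph (fun i : int => kappa ^ i)) => // i j; rewrite expfzDr.
Qed.

(** * The law of the restricted tree, from the clauses defining a special tree *)

Section special_tree_law.
Context d (W : measurableType d) (Pr : probability W R).
Variables (T : {RV Pr >-> mtreeF}) (V : nat -> W -> seq nat).
Variables (pn ps : nat -> bool -> R) (m : R).
Hypothesis pn_ge0 : forall k e, 0 <= pn k e.
Hypothesis m_ge0 : 0 <= m.
Hypothesis psE : forall k e, ps k e = pn k e * k%:R / m.
Hypothesis HT : special_tree T V pn ps.

Let restrT n t : set W := [set w | restr n (T w) = restr n t].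

Let measurable_restrT n t : measurable (restrT n t).
Proof.
exact: (measurable_funPTI T (measurable_Fn (Fn_restr n t))).
Qed.

Let measurable_V n u : measurable (V n @^-1` [set u]).
Proof. by case: HT. Qed.

(** The clauses of [special_tree] fix the special nodes of generations 0 to [n]; this is the
    discrete variable whose values are summed over to forget them. *)
Let past n w := [seq V j w | j <- iota 0 n.+1].

Let nth_past n w j : (j <= n)%N -> nth [::] (past n w) j = V j w.
Proof.
move=> jn; rewrite (nth_map 0%N) ?size_iota ?ltnS// nth_iota ?ltnS//.
Qed.

Let pastP n w y : past n w = y <->
  size y = n.+1 /\ forall j, (j <= n)%N -> V j w = nth [::] y j.
Proof.
split=> [<-|[sy Hy]].
  split; first by rewrite size_map size_iota.
  by move=> j jn; rewrite nth_past.
apply: (@eq_from_nth _ [::]); first by rewrite size_map size_iota.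
by move=> j; rewrite size_map size_iota ltnS => jn; rewrite nth_past// Hy.
Qed.

Let measurable_past n y : measurable (past n @^-1` [set y]).
Proof.
have [sy|sy] := eqVneq (size y) n.+1; last first.
  rewrite (_ : _ @^-1` _ = set0)//; apply/seteqP; split => // w /= /pastP[].
  by move=> E; rewrite E eqxx in sy.
rewrite (_ : _ @^-1` _ =
    \bigcap_(j in [set j | (j <= n)%N]) V j @^-1` [set nth [::] y j]).
  by apply: bigcap_measurableType => j _; exact: measurable_V.
apply/seteqP; split => w /= => [/pastP[_ Hy] j|Hy]; first exact: Hy.
by apply/pastP; split.
Qed.

(** The factor [c] does not depend on the past [y], so an identity valid on each fibre survives the
    countable sum. *)
Let sum_past n A B (c : R) : 0 <= c -> measurable A -> measurable B ->
  (forall y, size y = n.+1 ->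
     Pr (A `&` past n @^-1` [set y]) = (Pr (B `&` past n @^-1` [set y]) * c%:E)%E) ->
  Pr A = (Pr B * c%:E)%E.
Proof.
move=> c0 mA mB AB.
rewrite (measure_fibers (@measurable_past n) Pr mA).
rewrite (measure_fibers (@measurable_past n) Pr mB) muleC -esumZl//.
apply: eq_esum => y _; have [sy|sy] := eqVneq (size y) n.+1.
  exact: (etrans (AB y sy) (muleC _ _)).
rewrite (_ : past n @^-1` _ = set0) ?setI0 ?measure0 ?mule0//.
by apply/seteqP; split => // w /= /pastP[E]; rewrite E eqxx in sy.
Qed.

Let historyE n k t y : size y = k.+1 ->
  restrT n t `&` past k @^-1` [set y] = history T V n k t (nth [::] y).
Proof.
move=> sy; apply/seteqP; split => w /= [tw] => [/pastP[_ Hy]|Hy]; split => //.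
by apply/pastP.
Qed.

Let grow n t u : level t n u ->
  Pr (restrT n.+1 t `&` V n @^-1` [set u]) =
  (Pr (restrT n t `&` V n @^-1` [set u]) *
   (ps (nchild t u) (eta t u) *
    \prod_(v <- fset_set (level t n) | v != u) pn (nchild t v) (eta t v))%:E)%E.
Proof.
move=> tu; have c0 : 0 <= ps (nchild t u) (eta t u) *
    \prod_(v <- fset_set (level t n) | v != u) pn (nchild t v) (eta t v).
  by rewrite mulr_ge0 ?prodr_ge0// psE !mulr_ge0// invr_ge0.
apply: (sum_past (n := n)) => //; try exact: measurableI.
move=> y sy; have [yu|yu] := eqVneq (nth [::] y n) u; last first.
  have E k : restrT k t `&` V n @^-1` [set u] `&` past n @^-1` [set y] = set0.
    apply/seteqP; split => // w [[_ /= Vu] /pastP[_ Hy]].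
    by move: yu; rewrite -Hy// Vu eqxx.
  by rewrite !E measure0 mul0e.
have E k : restrT k t `&` V n @^-1` [set u] `&` past n @^-1` [set y] =
    history T V k n t (nth [::] y).
  rewrite -historyE// -setIA; congr (_ `&` _); apply: setIidr.
  by move=> w /pastP[_ Hy] /=; rewrite Hy.
by rewrite !E; case: HT => _ _ + _ => ->; rewrite yu.
Qed.

Let spread n t u : level t n.+1 u ->
  Pr (restrT n.+1 t `&` V n.+1 @^-1` [set u]) =
  (Pr (restrT n.+1 t) * ((Zn n.+1 t)%:R^-1)%:E)%E.
Proof.
move=> tu.
have mA : measurable (restrT n.+1 t `&` V n.+1 @^-1` [set u]) by exact: measurableI.
have c0 : 0 <= (Zn n.+1 t)%:R^-1 :> R by rewrite invr_ge0.
apply: (sum_past (n := n) c0 mA (measurable_restrT n.+1 t)) => y sy.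
(* The past [y] extended by [u] is the sequence of special nodes to which the clause on uniform
   choice is applied. *)
have yu : nth [::] (rcons y u) n.+1 = u.
  by rewrite nth_rcons sy ltnn eqxx.
have yE j : (j <= n)%N -> nth [::] (rcons y u) j = nth [::] y j.
  by move=> jn; rewrite nth_rcons sy ltnS jn.
have hist_n : history T V n.+1 n t (nth [::] (rcons y u)) =
    restrT n.+1 t `&` past n @^-1` [set y].
  rewrite historyE//; apply/seteqP; split => w [tw Hw]; split => // j jn.
    by rewrite Hw// yE.
  by rewrite Hw// yE.
have hist_Sn : history T V n.+1 n.+1 t (nth [::] (rcons y u)) =
    restrT n.+1 t `&` V n.+1 @^-1` [set u] `&` past n @^-1` [set y].
  apply/seteqP; split => w.
    move=> [tw Hw]; split; first by split => //=; rewrite Hw.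
    by apply/pastP; split => // j jn; rewrite -yE// Hw// ltnW.
  move=> [[tw Vu] /pastP[_ Hy]]; split => // j; rewrite leq_eqVlt.
  by move=> /predU1P[->|]; [rewrite yu|rewrite ltnS => jn; rewrite yE// Hy].
by rewrite -hist_Sn -hist_n; case: HT => _ _ _ ->//; rewrite yu.
Qed.

Let total n k t : (k <= n)%N -> Pr (restrT n t) =
  (\sum_(u <- fset_set (level t k)) Pr (restrT n t `&` V k @^-1` [set u]))%E.
Proof.
move=> kn; rewrite (measure_fibers (measurable_V k) Pr (measurable_restrT n t)).
rewrite (esumID (level t k)) ?setTI; last by move=> u _; exact: measure_ge0.
(* A word outside level [k] of [t] can be special only on the null set where [V k] leaves the
   tree. *)
rewrite [X in (_ + X)%E]esum1 ?adde0; last first.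
  move=> u ntu; have [_ /(_ k) [N [mN N0 HN]] _ _] := HT.
  apply: (subset_measure0 _ mN _ N0); first exact: measurableI.
  move=> w [tw /= Vu]; apply: HN; rewrite /= (restr_level kn tw) Vu => h.
  exact: ntu.
by rewrite esum_fset ?fsbig_finite//; exact: finite_level.
Qed.

Lemma special_tree_restr n t : Pr [set w | restr n (T w) = restr n t] =
  ((Zn n t)%:R / m ^+ n *
   \prod_(u <- fset_set (below t n)) pn (nchild t u) (eta t u))%:E.
Proof.
rewrite -/(restrT n t); elim: n t => [|n IHn] t.
  rewrite Zn0 below0 fset_set0 big_nil expr0 divr1 mulr1 -(probability_setT Pr).
  by congr (Pr _); apply/seteqP; split => // w _; exact: restr_root.
(* The factor [Zn n t] of the induction hypothesis cancels against the uniform choice, so the joint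
   mass is the same for every [u]; at generation 0 the root is the only candidate. *)
have uniform u : level t n u -> Pr (restrT n t `&` V n @^-1` [set u]) =
    ((m ^+ n)^-1 *
     \prod_(v <- fset_set (below t n)) pn (nchild t v) (eta t v))%:E.
  move=> tu; transitivity (Pr (restrT n t) * ((Zn n t)%:R^-1)%:E)%E.
    case: n IHn tu => [|n] _ tu; last exact: spread.
    rewrite Zn0 invr1 mule1 (total t (leqnn 0)) level0 fset_set1 big_seq_fset1.
    by move: tu; rewrite level0 => ->.
  rewrite IHn -EFinM; congr EFin.
  have Z0 : (Zn n t)%:R != 0 :> R.
    rewrite pnatr_eq0 -lt0n /Zn cardfs_gt0; apply/fset0Pn; exists u.
    exact/mem_level.
  by move: (m ^+ n)^-1 => c; field.
rewrite (total t (leqnSn n)) big_seq.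
under eq_bigr => u /mem_level tu do rewrite (grow tu) (uniform _ tu) -EFinM.
rewrite -big_seq sumEFin; congr EFin.
set B := \prod_(v <- _) _.
(* The factor [pn] contained in [ps] fills the gap left by [u], so the product over the level no
   longer depends on [u] and leaves the sum. *)
transitivity (\sum_(u <- fset_set (level t n)) (m ^+ n.+1)^-1 * (B *
   \prod_(u <- fset_set (level t n)) pn (nchild t u) (eta t u)) * (nchild t u)%:R).
  apply: eq_big_seq => u tu; rewrite psE [in RHS](bigD1_seq u)//= exprSr invfM.
  by ring.
rewrite -mulr_sumr -natr_sum -ZnS -(big_belowS _ _ t n).
by rewrite mulrC mulrA.
Qed.

End special_tree_law.

End law_of_mtree.

(** * The generating function *)

Lemma esum_nat_bool (R : realType) (a : nat * bool -> \bar R) :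
  (forall c, 0 <= a c)%E ->
  (\esum_(c in [set: nat * bool]) a c =
   \sum_(k <oo) (a (k, false) + a (k, true)))%E.
Proof.
move=> a0; rewrite nneseries_esumT; last by move=> k; rewrite adde_ge0.
rewrite (_ : [set: nat * bool] = [set: nat] `*`` (fun=> [set: bool])); last first.
  by apply/seteqP; split.
transitivity (\esum_(c in [set: nat] `*`` (fun=> [set: bool])) a (c.1, c.2))%E.
  by apply: eq_esum => -[].
rewrite -(@esum_esum _ _ _ _ _ (fun k e => a (k, e)))//; apply: eq_esum => k _.
rewrite (esumID [set false])// !setTI (_ : ~` [set false] = [set true]).
  by rewrite !esum_set1.
by apply/seteqP; split => -[] //= /(_ erefl).
Qed.

Lemma nneseries_EFin (R : realType) (u : nat -> R) : cvgn (series u) ->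
  (\sum_(k <oo) (u k)%:E)%E = (limn (series u))%:E.
Proof.
move=> cu; rewrite -EFin_lim//; apply/congr_lim/funext => n.
by rewrite /= -sumEFin.
Qed.

Lemma is_cvg_series_lty (R : realType) (u : nat -> R) : (forall k, 0 <= u k) ->
  (\sum_(k <oo) (u k)%:E < +oo)%E -> cvgn (series u).
Proof.
move=> u0 uoo; apply: nondecreasing_is_cvgn; first exact: nondecreasing_series.
exists (fine (\sum_(k <oo) (u k)%:E)%E) => _ [n _ <-].
rewrite -lee_fin fineK; last first.
  by rewrite ge0_fin_numE//; apply: nneseries_ge0 => k _ _; rewrite lee_fin.
by rewrite -sumEFin; apply: nneseries_lim_ge => k _ _; rewrite lee_fin.
Qed.

(** Comparison with the series at [r]: in r^(k+1) - x^(k+1) = (r - x) sum_i r^(k-i) x^i each of the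
    k+1 terms is at least x^k, whence (k+1) x^k <= r^(k+1) / (r - x). *)
Lemma is_cvg_pseries_diffs (R : realType) (c : nat -> R) (x r : R) :
  (forall k, 0 <= c k) -> 0 <= x < r -> cvgn (pseries c r) ->
  cvgn (pseries (pseries_diffs c) x).
Proof.
move=> c0 /andP[x0 xr] cr; have r0 : 0 < r by exact: le_lt_trans xr.
have xr0 : 0 < r - x by rewrite subr_gt0.
pose v k := (r - x)^-1 * (c k.+1 * r ^+ k.+1).
have cv : cvgn (series v).
  rewrite (_ : series v = fun n =>
      (r - x)^-1 * (pseries c r n.+1 - c 0%N)).
    apply: is_cvgM; first exact: is_cvg_cst.
    apply: is_cvgB; last exact: is_cvg_cst.
    by apply/cvg_ex; exists (limn (pseries c r)); rewrite (cvg_shiftS (pseries c r)).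
  apply/funext => n; rewrite /pseries /series /= big_nat_recl//= expr0 mulr1.
  by rewrite [c 0%N + _]addrC addrK mulr_sumr.
apply: series_le_cvg cv => k.
- by rewrite !mulr_ge0// exprn_ge0.
- by rewrite !mulr_ge0// ?invr_ge0 ?exprn_ge0// ltW.
rewrite /mk_sequence.
rewrite (_ : _ * x ^+ k = c k.+1 * (k.+1%:R * x ^+ k)); last first.
  by rewrite /pseries_diffs; ring.
rewrite /v [leRHS]mulrCA ler_wpM2l// ler_pdivlMl//.
have : (r - x) * (k.+1%:R * x ^+ k) <= r ^+ k.+1 - x ^+ k.+1.
  rewrite subrXX ler_wpM2l ?(ltW xr0)//.
  rewrite mulr_natl -[X in _ *+ X]card_ord -sumr_const; apply: ler_sum => i _.
  have ik : (i <= k)%N by rewrite -ltnS.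
  rewrite -[X in x ^+ X](subnK ik) exprD ler_wpM2r ?exprn_ge0//.
  by rewrite /= lerXn2r ?nnegrE ?(ltW r0)// ltW.
have : 0 <= x ^+ k.+1 by rewrite exprn_ge0.
lra.
Qed.

Section generating_function.
Variables (R : realType) (p q : nat -> R).
Hypothesis hp : offspring_distribution p.
Hypothesis hq : mark_function q.
Variable P : probability mtreeF R.
Hypothesis hP : marked_GW p q P.
Variable s : R.
Hypothesis hs : 0 < s < 1.

Lemma p0_ge0 k e : 0 <= p0 p q k e.
Proof.
have [p_ge0 _] := hp; rewrite /p0 mulr_ge0//; have /andP[q0 q1] := hq k.
by case: e => //; rewrite subr_ge0.
Qed.

(** Puts the event in the form evaluated by [marked_GW]; the representative has a root of type [c]
    and childless unmarked nodes above it. *)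
Lemma root_fiber (c : nat * bool) :
  [set x | node_type x [::] = c] =
  [set x | restr 1 x =
    restr 1 (tree_of (fun u => if u == [::] then c else (0%N, false)))].
Proof.
have b1 x u : below x 1 u -> u = [::] by case=> _ /[!ltnS] /[!leqn0] /nilP.
apply/seteqP; split => x /= E.
  by apply/esym/restr_tree_of => u /b1 ->; rewrite eqxx.
move/esym/restr_tree_of : E => /(_ [::]) /= <- //; split => //; exact: nodes_root.
Qed.

Lemma measurable_root_fiber c :
  measurable ((fun x : mtreeF => node_type x [::]) @^-1` [set c]).
Proof.
rewrite (_ : _ @^-1` _ = [set x : mtreeF | node_type x [::] = c])// root_fiber.
exact: measurable_Fn (Fn_restr _ _).
Qed.

Lemma root_law c :
  P ((fun x : mtreeF => node_type x [::]) @^-1` [set c]) = (p0 p q c.1 c.2)%:E.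
Proof.
rewrite (_ : _ @^-1` _ = [set x : mtreeF | node_type x [::] = c])// root_fiber hP//.
rewrite big_belowS below0 fset_set0 big_nil level0 fset_set1 big_seq_fset1 /= mul1r.
set t := tree_of _; have tc : node_type t [::] = c by rewrite node_type_tree_of.
by rewrite -{}tc.
Qed.

Lemma Zn1 x : Zn 1 x = (node_type x [::]).1.
Proof. by rewrite ZnS level0 fset_set1 big_seq_fset1. Qed.

Lemma Mn1 x : Mn 1 x = (node_type x [::]).2.
Proof. by rewrite MnS Mn0 level0 fset_set1 big_seq_fset1. Qed.

(** The coefficient of t^k in the power series f_s(t). *)
Definition fgen_coef k : R := p0 p q k false + s * p0 p q k true.
Local Notation alpha := fgen_coef.

Lemma fgen_coef_ge0 k : 0 <= alpha k.
Proof.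
have /andP[/ltW s0 _] := hs.
by apply: addr_ge0; [|apply: mulr_ge0 => //]; exact: p0_ge0.
Qed.

Lemma fgen_coefE k : alpha k = p k - (1 - s) * (p k * q k).
Proof. by rewrite /fgen_coef /p0; ring. Qed.

Lemma fgen_coef_le k : alpha k <= p k.
Proof.
case/andP: hs => _ s1; rewrite fgen_coefE gerBl mulr_ge0 ?subr_ge0 ?(ltW s1)//.
by have [p_ge0 _] := hp; have /andP[q0 _] := hq k; rewrite mulr_ge0.
Qed.

Lemma fgen_esum t : 0 <= t ->
  ('E_P[(fun x : mtreeF => s ^+ Mn 1 x * t ^+ Zn 1 x)%R] =
   \esum_(c in [set: nat * bool]) (s ^+ c.2 * t ^+ c.1 * p0 p q c.1 c.2)%:E)%E.
Proof.
move=> t0; case/andP: hs => s0 _.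
rewrite unlock; under eq_integral do rewrite Zn1 Mn1.
rewrite (ge0_integral_comp_fibers measurable_root_fiber P
  (h := fun c => (s ^+ c.2 * t ^+ c.1)%:E)); last first.
  by move=> c; rewrite lee_fin mulr_ge0 ?exprn_ge0// ltW.
by apply: eq_esum => c _; rewrite [RHS]EFinM -root_law.
Qed.

Lemma fgen_nneseries t : 0 <= t ->
  ('E_P[(fun x : mtreeF => s ^+ Mn 1 x * t ^+ Zn 1 x)%R] =
   \sum_(k <oo) (alpha k * t ^+ k)%:E)%E.
Proof.
move=> t0; rewrite fgen_esum// esum_nat_bool => [|c]; last first.
  case/andP: hs => s0 _.
  by rewrite lee_fin mulr_ge0 ?p0_ge0// mulr_ge0 ?exprn_ge0// ltW.
apply: eq_eseriesr => k _ /=; rewrite -EFinD; congr EFin.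
by rewrite /fgen_coef expr0 expr1; ring.
Qed.

Lemma is_cvg_fgen_series : cvgn (pseries alpha 1).
Proof.
rewrite (_ : pseries alpha 1 = series alpha); last first.
  by congr series; apply/funext => k; rewrite /= expr1n mulr1.
apply: is_cvg_series_lty; first exact: fgen_coef_ge0.
have [p_ge0 p1] := hp; apply: (@le_lt_trans _ _ 1%E); last by rewrite ltry.
rewrite -p1; apply: lee_nneseries => k *; rewrite lee_fin.
  exact: fgen_coef_ge0.
exact: fgen_coef_le.
Qed.

Lemma is_cvg_fgen t : 0 <= t <= 1 -> cvgn (pseries alpha t).
Proof.
move=> /andP[t0 t1]; apply: series_le_cvg is_cvg_fgen_series => k.
- by rewrite mulr_ge0 ?fgen_coef_ge0// exprn_ge0.
- by rewrite mulr_ge0 ?fgen_coef_ge0// exprn_ge0.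
- by rewrite ler_wpM2l ?fgen_coef_ge0// expr1n exprn_ile1.
Qed.

Lemma fgen_pseries t : 0 <= t <= 1 -> fgen P s t = limn (pseries alpha t).
Proof.
move=> t01; have /andP[t0 _] := t01.
by rewrite /fgen fgen_nneseries// nneseries_EFin//; exact: is_cvg_fgen.
Qed.

(** Differentiating the series requires its first and second derived series to converge at some
    [r > t]. Each derivation costs a slightly larger radius, hence t < r < r' < 1, starting from
    convergence at 1. *)
Lemma fgen_derive t : 0 < t < 1 ->
  derive1 (fgen P s) t = limn (pseries (pseries_diffs alpha) t).
Proof.
move=> /andP[t0 t1]; pose r := (t + 1) / 2; pose r' := (r + 1) / 2.
have tr : t < r by rewrite /r; lra.
have rr' : r < r' by rewrite /r' /r; lra.
have r'1 : r' < 1 by rewrite /r' /r; lra.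
have d0 k : 0 <= pseries_diffs alpha k.
  by rewrite /pseries_diffs mulr_ge0// fgen_coef_ge0.
have D : is_derive t (1 : R) (fun x => limn (pseries alpha x))
    (limn (pseries (pseries_diffs alpha) t)).
  apply: (@pseries_snd_diffs _ _ r).
  - by apply: is_cvg_fgen; lra.
  - apply: (is_cvg_pseries_diffs fgen_coef_ge0 _ is_cvg_fgen_series); lra.
  - apply: (is_cvg_pseries_diffs (r := r') d0); first lra.
    apply: (is_cvg_pseries_diffs fgen_coef_ge0 _ is_cvg_fgen_series); lra.
  - by rewrite !ger0_norm; lra.
(* [fgen] is identified with the power series on [0, 1], a neighbourhood of [t] because 0 < t <
   1. *)
rewrite derive1E; have [_ <-] := D; apply: near_eq_derive.
have : \forall x \near t, x \in `]0, 1[.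
  by apply: near_in_itvoo; rewrite in_itv /= t0.
apply: filterS => x; rewrite in_itv /= => /andP[x0 x1].
by rewrite fgen_pseries// ltW//= ltW.
Qed.

End generating_function.

(** * The fixed point and the total masses of the two offspring laws *)

Lemma nneseries_ge_term (R : realType) (u : nat -> \bar R) k :
  (forall n, 0 <= u n)%E -> (u k <= \sum_(n <oo) u n)%E.
Proof.
move=> u0; rewrite (nneseriesD1 (n := k))// leeDl//.
by apply: nneseries_ge0.
Qed.

Section fixed_point.
Variables (R : realType) (p q : nat -> R).
Hypothesis hp : offspring_distribution p.
Hypothesis hp01 : p 0%N + p 1%N < 1.
Hypothesis hp0 : 0 < p 0%N.
Hypothesis hq : mark_function q.
Hypothesis hpq : exists k, 0 < p k * q k.
Variable P : probability mtreeF R.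
Hypothesis hP : marked_GW p q P.
Variables (s kappa : R).
Hypothesis hs : 0 < s < 1.
Hypothesis hkappa : 0 <= kappa <= 1 /\ fgen P s kappa = kappa.
Local Notation alpha := (fgen_coef p q s).
Let m := derive1 (fgen P s) kappa.

Let alpha_ge0 := fgen_coef_ge0 hp hq hs.

(** A mark costs one factor [s] at most, so positivity of [p k] passes to the coefficient. *)
Lemma fgen_coef_ge k : s * p k <= alpha k.
Proof.
have [p_ge0 _] := hp; have /andP[q0 q1] := hq k; have /andP[_ s1] := hs.
rewrite fgen_coefE -subr_ge0.
have -> : p k - (1 - s) * (p k * q k) - s * p k = (1 - s) * (p k * (1 - q k)) by ring.
by rewrite !mulr_ge0 ?subr_ge0// ltW.
Qed.

Let fgenE t : 0 <= t <= 1 ->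
  (\sum_(k <oo) (alpha k * t ^+ k)%:E)%E = (fgen P s t)%:E.
Proof.
move=> t01; rewrite (fgen_pseries hp hq hP hs t01) nneseries_EFin//.
exact: (is_cvg_fgen hp hq hs t01).
Qed.

(** f_s(0) is at least s p(0) > 0, so 0 is not a fixed point. *)
Lemma fixed_point_gt0 : 0 < kappa.
Proof.
have [/andP[k0 k1] kE] := hkappa; rewrite lt_neqAle k0 andbT eq_sym.
apply/eqP => kappa0.
have a0 : 0 < alpha 0.
  by rewrite (lt_le_trans _ (fgen_coef_ge _))// mulr_gt0//; case/andP: hs.
have := @nneseries_ge_term _ (fun k => (alpha k * 0 ^+ k)%:E) 0%N.
rewrite fgenE ?lexx ?ler01//.
have -> : fgen P s 0 = 0 by move: kE; rewrite kappa0.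
rewrite expr0 mulr1 lee_fin leNgt a0 => /(_ _)/negP; apply => // k.
by rewrite lee_fin mulr_ge0// exprn_ge0.
Qed.

(** f_s(1) = 1 - (1 - s) sum_k p(k) q(k) < 1, so 1 is not a fixed point. *)
Lemma fixed_point_lt1 : kappa < 1.
Proof.
have [/andP[k0 k1] kE] := hkappa; rewrite lt_neqAle k1 andbT.
apply/eqP => kappa1; have [k pqk] := hpq; have /andP[_ s1] := hs.
have [p_ge0 p1] := hp.
have pq0 i : 0 <= (1 - s) * (p i * q i).
  by have /andP[q0 _] := hq i; rewrite !mulr_ge0 ?subr_ge0// ltW.
have pq0' i : (0 <= ((1 - s) * (p i * q i))%:E)%E by rewrite lee_fin.
have : (\sum_(k <oo) (alpha k)%:E + \sum_(k <oo) ((1 - s) * (p k * q k))%:E = 1)%E.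
  rewrite -nneseriesD//=; last first.
    by move=> i _ _; rewrite lee_fin.
  rewrite -p1; apply: eq_eseriesr => i _.
  by rewrite -EFinD fgen_coefE subrK.
have -> : (\sum_(k <oo) (alpha k)%:E = 1)%E.
  rewrite -[RHS]/(1%:E) -{1}kappa1 -kE -fgenE ?k0//.
  by apply: eq_eseriesr => i _; rewrite kappa1 expr1n mulr1.
have : (1 + ((1 - s) * (p k * q k))%:E <=
    1 + \sum_(i <oo) ((1 - s) * (p i * q i))%:E)%E.
  by rewrite leeD2l//; exact: (nneseries_ge_term k pq0').
move=> /[swap] ->; rewrite -EFinD lee_fin gerDl leNgt.
by rewrite mulr_gt0// subr_gt0.
Qed.

Let kappa_gt0 := fixed_point_gt0.
Let kappa_lt1 := fixed_point_lt1.

Let mE : m = limn (pseries (pseries_diffs alpha) kappa).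
Proof. by rewrite /m (fgen_derive hp hq hP)// kappa_gt0. Qed.

Let is_cvg_diffs : cvgn (pseries (pseries_diffs alpha) kappa).
Proof.
apply: (is_cvg_pseries_diffs (r := 1)) => //.
  by rewrite kappa_lt1 ltW// kappa_gt0.
exact: is_cvg_fgen_series.
Qed.

(** Some p(k) with k >= 2 is positive, and so is its term in the series f_s'(kappa), all of whose
    terms are nonnegative. *)
Lemma derive_fgen_gt0 : 0 < m.
Proof.
have [k pk] : exists k, 0 < p k.+2.
  apply: contrapT => /forallNP pk; have [p_ge0] := hp.
  rewrite (nneseries_split 0 2) => [|k _]; last by rewrite lee_fin.
  rewrite eseries0 ?adde0 => [|[|[|k]]// _ _]; last first.
    congr EFin; apply/eqP; rewrite eq_le p_ge0 leNgt andbT; exact/negP/pk.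
  rewrite add0n sumEFin !big_nat_recr//= big_nil add0r => -[E].
  by move: hp01; rewrite E ltxx.
rewrite -lte_fin mE -nneseries_EFin//.
apply: (@lt_le_trans _ _ (pseries_diffs alpha k.+1 * kappa ^+ k.+1)%:E).
  rewrite lte_fin !mulr_gt0// ?ltr0n// ?exprn_gt0 ?kappa_gt0//.
  rewrite (lt_le_trans _ (fgen_coef_ge _))// mulr_gt0//; by case/andP: hs.
apply: (nneseries_ge_term (u := fun i => (pseries_diffs alpha i * kappa ^+ i)%:E)) => i.
by rewrite lee_fin !mulr_ge0// exprn_ge0// ltW// kappa_gt0.
Qed.

(** The total mass is f_s(kappa) / kappa. *)
Lemma esum_p_normal :
  (\esum_(c in [set: nat * bool]) (p_normal p q s kappa c.1 c.2)%:E = 1)%E.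
Proof.
have k0 := kappa_gt0; have /andP[s0 _] := hs; have [/andP[k0' k1] kE] := hkappa.
transitivity (\esum_(c in [set: nat * bool])
  (kappa^-1%:E * (s ^+ c.2 * kappa ^+ c.1 * p0 p q c.1 c.2)%:E))%E.
  apply: eq_esum => -[k e] _ /=; rewrite -EFinM /p_normal expfzDr ?gt_eqF//.
  by congr EFin; rewrite exprN1 -exprnP; ring.
rewrite esumZl ?invr_ge0//; last first.
  by move=> c; rewrite lee_fin mulr_ge0 ?p0_ge0// mulr_ge0 ?exprn_ge0// ltW.
rewrite -(fgen_esum hP hs)// (fgen_nneseries hp hq hP hs)// fgenE ?k0'// kE.
by rewrite -EFinM mulVf// gt_eqF.
Qed.

Lemma p_normal_ge0 k e : 0 <= p_normal p q s kappa k e.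
Proof.
have /andP[s0 _] := hs.
by rewrite mulr_ge0 ?exprz_ge0 ?(ltW kappa_gt0)// mulr_ge0 ?p0_ge0// exprn_ge0// ltW.
Qed.

Lemma p_special_ge0 k e : 0 <= p_special p q s kappa m k e.
Proof.
by rewrite mulr_ge0 ?invr_ge0 ?(ltW derive_fgen_gt0)// mulr_ge0// p_normal_ge0.
Qed.

(** The total mass is f_s'(kappa) / m. *)
Lemma esum_p_special :
  (\esum_(c in [set: nat * bool]) (p_special p q s kappa m c.1 c.2)%:E = 1)%E.
Proof.
have k0 := kappa_gt0; have m0 := derive_fgen_gt0.
rewrite esum_nat_bool => [|c]; last by rewrite lee_fin p_special_ge0.
pose u i := i%:R * alpha i * kappa ^+ i.-1.
have u0 i : 0 <= u i by rewrite mulr_ge0 ?exprn_ge0 ?(ltW k0)// mulr_ge0.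
transitivity (\sum_(i <oo) (m^-1%:E * (u i)%:E))%E.
  apply: eq_eseriesr => i _ /=; rewrite -EFinD -EFinM; congr EFin.
  rewrite /p_special /p_normal /u /fgen_coef expr0 expr1.
  (* At 0 the factor [k] cancels kappa^(-1), so the truncated exponent [i.-1] in [u] is harmless. *)
  case: i => [|i]; first by rewrite !(mulr0, mul0r) addr0.
  rewrite [X in kappa ^ X](_ : _ = i :> int); last by rewrite intS addrC addKr.
  by rewrite -exprnP /=; ring.
rewrite nneseriesZl => [|i _]; last by rewrite lee_fin.
have /(cvg_lim (@Rhausdorff R)) uE := pseries_diffs_equiv is_cvg_diffs.
rewrite nneseries_EFin; last exact: is_cvg_pseries_diffs_equiv.
by rewrite uE -mE -EFinM mulVf// gt_eqF.
Qed.

End fixed_point.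

(** * Construction of a special tree *)

Lemma esum_sum_type (R : realType) (A B : countType) (a : A + B -> \bar R) :
  (forall x, 0 <= a x)%E ->
  (\esum_(x in [set: A + B]) a x =
   \esum_(x in [set: A]) a (inl x) + \esum_(x in [set: B]) a (inr x))%E.
Proof.
move=> a0; rewrite (esumID (range inl))// !setTI.
rewrite (_ : ~` range inl = range inr); last first.
  apply/seteqP; split => [[x nx|x _]|_ [x _ <-] [y _]//]; last by exists x.
  by exfalso; apply: nx; exists x.
by rewrite !esum_image// => x y _ _ [].
Qed.

(** The empty set receives the point mass at the root, so that every index carries a probability
    law; the generations of the constructed tree are never empty. *)
Definition unif_law (R : realType) (L : {fset seq nat}) (v : seq nat) : R :=
  if L == fset0 then (v == [::])%:R else
  if v \in L then (#|` L|)%:R^-1 else 0.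

Lemma unif_law_ge0 (R : realType) L v : 0 <= unif_law R L v.
Proof. by rewrite /unif_law; case: ifP => // _; case: ifP => // _; rewrite invr_ge0. Qed.

Lemma esum_unif_law (R : realType) (L : {fset seq nat}) :
  (\esum_(v in [set: seq nat]) (unif_law R L v)%:E = 1)%E.
Proof.
have [L0|L0] := eqVneq L fset0.
  rewrite (esumID [set [::]])//; last by move=> v _; rewrite lee_fin unif_law_ge0.
  rewrite setTI esum_set1 ?lee_fin ?unif_law_ge0// esum1 ?adde0.
    by rewrite /unif_law L0 eqxx.
  by move=> v [_ /= /eqP/negbTE v0]; rewrite /unif_law L0 eqxx v0.
rewrite (esumID [set` L])//; last by move=> v _; rewrite lee_fin unif_law_ge0.
rewrite setTI [X in (_ + X)%E]esum1 ?adde0; last first.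
  by move=> v [_ /= /negP/negbTE vL]; rewrite /unif_law (negbTE L0) vL.
rewrite esum_fset//; last by move=> v _; rewrite lee_fin unif_law_ge0.
rewrite fsbig_finite//= set_fsetK sumEFin; congr EFin.
rewrite (eq_big_seq (fun=> (#|` L|)%:R^-1)); last first.
  by move=> v vL; rewrite /unif_law (negbTE L0) vL.
rewrite big_const_seq count_predT iter_addr addr0 -[_ *+ _]mulr_natr.
rewrite -[X in _ * X%:R]/(#|` L|) mulVf//.
by rewrite pnatr_eq0 -lt0n cardfs_gt0.
Qed.

Section existence.
Variables (R : realType) (pn ps : nat -> bool -> R) (m : R).
Hypothesis pn_ge0 : forall k e, 0 <= pn k e.
Hypothesis m_ge0 : 0 <= m.
Hypothesis psE : forall k e, ps k e = pn k e * k%:R / m.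
Hypothesis pn_sum : (\esum_(c in [set: nat * bool]) (pn c.1 c.2)%:E = 1)%E.
Hypothesis ps_sum : (\esum_(c in [set: nat * bool]) (ps c.1 c.2)%:E = 1)%E.

(* [inl (b, u)] carries the type of node u when it is special (b) or normal
   (~~ b), and [inr (n, L)] the choice of the special node of generation n when
   that generation is L. *)
Let I : countType := ((bool * seq nat) + (nat * {fset seq nat}))%type.
Let E : countType := ((nat * bool) + seq nat)%type.

Definition special_law (i : I) (x : E) : R :=
  match i, x with
  | inl (b, _), inl (k, e) => if b then ps k e else pn k e
  | inr (_, L), inr v => unif_law R L v
  | _, _ => 0
  end.

Lemma special_law_ge0 i x : 0 <= special_law i x.
Proof.
case: i x => [[[] u]|[n L]] [[k e]|v] //=; last exact: unif_law_ge0.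
by rewrite psE !mulr_ge0// invr_ge0.
Qed.

Lemma esum_special_law i :
  (\esum_(x in [set: E]) (special_law i x)%:E = 1)%E.
Proof.
rewrite esum_sum_type; last by move=> x; rewrite lee_fin special_law_ge0.
case: i => [[b u]|[n L]] /=; last by rewrite esum1 ?add0e ?esum_unif_law// => -[].
rewrite [X in (_ + X)%E]esum1 ?adde0//.
by case: b; [rewrite -[RHS]ps_sum|rewrite -[RHS]pn_sum]; apply: eq_esum => -[].
Qed.

Section construction.
Context d (W : measurableType d) (Pr : probability W R) (X : I -> W -> E).
Hypothesis mX : forall i e, measurable (X i @^-1` [set e]).
Hypothesis X_gt0 : forall i w, 0 < special_law i (X i w).
Hypothesis X_indep : forall (s : seq I) (a : I -> E), uniq s ->
  Pr [set w | forall i, i \in s -> X i w = a i] =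
  (\prod_(i <- s) special_law i (a i))%:E.

(** The fallback is never taken: [X_gt0] excludes values on the wrong side of the sum type. *)
Let type_of b u w : nat * bool :=
  if X (inl (b, u)) w is inl c then c else (0%N, false).

Let choice_of n L w : seq nat := if X (inr (n, L)) w is inr v then v else [::].

Let type_ofP b u w c : X (inl (b, u)) w = inl c <-> type_of b u w = c.
Proof.
rewrite /type_of; have := X_gt0 (inl (b, u)) w.
by case: (X _ w) => [c' _|v /=]; [split => [[]|->]|rewrite ltxx].
Qed.

Let choice_ofP n L w v : X (inr (n, L)) w = inr v <-> choice_of n L w = v.
Proof.
rewrite /choice_of; have := X_gt0 (inr (n, L)) w.
by case: (X _ w) => [c /=|v' _]; [rewrite ltxx|split => [[]|->]].
Qed.

(** The special law gives mass 0 to having no child, and every outcome has positive mass: the spine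
    never dies out. *)
Let type_of_special u w : (0 < (type_of true u w).1)%N.
Proof.
have := X_gt0 (inl (true, u)) w; rewrite (proj2 (type_ofP _ _ _ _) erefl).
case: (type_of true u w) => -[|k] e //=.
by rewrite psE mulr0 mul0r ltxx.
Qed.

Let choice_of_mem n L w : L != fset0 -> choice_of n L w \in L.
Proof.
move=> L0; have := X_gt0 (inr (n, L)) w; rewrite (proj2 (choice_ofP _ _ _ _) erefl) /=.
by rewrite /unif_law (negbTE L0); case: ifP => //; rewrite ltxx.
Qed.

(** The spine [v] is a parameter so that the definition serves both for the partial spines and for
    the complete one. *)
Let types (v : nat -> seq nat) w u := type_of (u == v (size u)) u w.

(* Only the special nodes of generations below n: they determine generation n,
   in which V n is then chosen. *)
Let Fixpoint spines (w : W) (n : nat) {struct n} : nat -> seq nat :=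
  if n is n'.+1 then fun j =>
    if j == n' then choice_of n' (fset_set (level (tree_of (types (spines w n') w)) n')) w
    else spines w n' j
  else fun _ => [::].

Let V n w := spines w n.+1 n.
Let T w : mtree := tree_of (types (V^~ w) w).

Let spinesE w n j : (j < n)%N -> spines w n j = V j w.
Proof.
elim: n => // n IHn; rewrite ltnS leq_eqVlt => /predU1P[->//|jn].
by rewrite /= ltn_eqF// IHn.
Qed.

Let VE n w : V n w = choice_of n (fset_set (level (T w) n)) w.
Proof.
rewrite {1}/V /= eqxx; congr (choice_of _ (fset_set _) _).
apply: (restr_level (leqnn n)); apply: eq_restr => u [tu un] [tu' _].
by rewrite !node_type_tree_of// /types spinesE.
Qed.

Let restr_T n t w : restr n (T w) = restr n t <->
  forall u, below t n u -> types (V^~ w) w u = node_type t u.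
Proof. exact: restr_tree_of. Qed.

(** Valid at every sample point: the special node has a child, so the next level is nonempty, and a
    choice from a nonempty level belongs to it. *)
Let level_V n w : level (T w) n (V n w).
Proof.
suff : fset_set (level (T w) n) != fset0.
  by move=> L0; apply/mem_level; rewrite VE; exact: choice_of_mem.
elim: n => [|n IHn].
  by apply/fset0Pn; exists [::]; apply/mem_level; rewrite level0.
have /mem_level[Tv vn] : V n w \in fset_set (level (T w) n).
  by rewrite VE; exact: choice_of_mem.
apply/fset0Pn; exists (rcons (V n w) 1%N); apply/mem_level.
split; last by rewrite size_rcons vn.
apply/(nchildP Tv) => //; have /= -> := congr1 fst (node_type_tree_of Tv).
by rewrite /types vn eqxx.
Qed.

(** Removes the mutual dependence of [T] and [V]: the right-hand side reads only variables whose
    indices are fixed by [t] and [v]. The types below level [n] need the special nodes of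
    generations below [n], hence [n <= k]; those are drawn from levels determined by [restr n],
    hence [k <= n.+1]. *)
Let historyP n k t v w : (n <= k <= n.+1)%N ->
  (restr n (T w) = restr n t /\ forall j, (j < k)%N -> V j w = v j) <->
  (forall u, below t n u -> types v w u = node_type t u) /\
  (forall j, (j < k)%N -> choice_of j (fset_set (level t j)) w = v j).
Proof.
move=> /andP[nk kn]; split => [[Tt Vv]|[tv cv]].
  split => [u tu|j jk].
    by rewrite -(restr_T n t w).1// /types Vv// (leq_trans tu.2).
  by rewrite -(restr_level _ Tt) -?VE ?Vv// -ltnS (leq_trans jk).
have restr_of j : (j <= n)%N -> (forall i, (i < j)%N -> V i w = v i) ->
    restr j (T w) = restr j t.
  move=> jn Vv; apply/restr_T => u [tu uj]; rewrite -tv.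
    by rewrite /types Vv.
  by split => //; exact: leq_trans jn.
have Vv j : (j < k)%N -> V j w = v j.
  elim/ltn_ind: j => j IHj jk.
  rewrite VE (restr_level (leqnn j) (restr_of j _ _)) ?cv//.
    by rewrite -ltnS (leq_trans jk).
  by move=> i ij; rewrite IHj// (ltn_trans ij).
split => //; apply: restr_of => // j jn; apply: Vv; exact: leq_trans nk.
Qed.

Let Pr_history n k t v : (n <= k <= n.+1)%N ->
  Pr [set w | restr n (T w) = restr n t /\ forall j, (j < k)%N -> V j w = v j] =
  (\prod_(u <- fset_set (below t n))
      (if u == v (size u) then ps else pn) (nchild t u) (eta t u) *
   \prod_(0 <= j < k) unif_law R (fset_set (level t j)) (v j))%:E.
Proof.
move=> nk.
pose idx u : I := inl (u == v (size u), u).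
pose jdx j : I := inr (j, fset_set (level t j)).
pose D := map idx (fset_set (below t n)) ++ map jdx (iota 0 k).
pose a (i : I) : E := match i with
  | inl (_, u) => inl (node_type t u) | inr (j, _) => inr (v j) end.
have uD : uniq D.
  rewrite cat_uniq !map_inj_uniq ?fset_uniq ?iota_uniq ?andbT//=.
  - by apply/hasPn => _ /mapP[j _ ->]; apply/negP => /mapP[].
  - by move=> i j [].
  - by move=> u u' [].
have := X_indep a uD; rewrite big_cat !big_map => PD.
transitivity ((\prod_(u <- fset_set (below t n)) special_law (idx u) (a (idx u)) *
    \prod_(j <- iota 0 k) special_law (jdx j) (a (jdx j)))%:E).
  rewrite -PD; congr (Pr _); apply/seteqP; split => w /=.
    move=> /(historyP _ _ _ nk)[tv cv] i; rewrite mem_cat => /orP[|] /mapP[u].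
      by move=> /mem_below tu ->; apply/type_ofP; exact: tv.
    by rewrite mem_iota add0n => /= uk ->; apply/choice_ofP; exact: cv.
  move=> Hw; apply/(historyP _ _ _ nk); split => [u tu|j jk].
    by apply/type_ofP; apply: (Hw (idx u)); rewrite mem_cat map_f//; exact/mem_below.
  apply/choice_ofP; apply: (Hw (jdx j)); rewrite mem_cat orbC map_f//.
  by rewrite mem_iota add0n.
rewrite /index_iota subn0; congr (_ * _)%:E; apply: eq_bigr => u _ //=.
by case: ifP.
Qed.

(** Measurability of the tree and of its spine is proved generation by generation: [restr n] of the
    tree uses only the earlier special nodes, and [V n] uses only [restr n] of the tree and one
    choice variable. *)
Let measurable_restr_T n t :
  (forall j u, (j < n)%N -> measurable (V j @^-1` [set u])) ->
  measurable [set w | restr n (T w) = restr n t].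
Proof.
move=> mV.
have mtype b u c : measurable (type_of b u @^-1` [set c]).
  rewrite (_ : _ @^-1` _ = X (inl (b, u)) @^-1` [set inl c])//.
  by apply/seteqP; split => w /type_ofP.
rewrite (_ : mkset _ = \bigcap_(u in below t n)
    [set w | types (V^~ w) w u = node_type t u]); last first.
  by apply/seteqP; split => w /= /restr_T.
apply: fin_bigcap_measurable; first exact: finite_below.
move=> u [_ un]; set c := node_type t u.
rewrite (_ : mkset _ =
    (V (size u) @^-1` [set u] `&` type_of true u @^-1` [set c]) `|`
    (~` (V (size u) @^-1` [set u]) `&` type_of false u @^-1` [set c])).
  by apply: measurableU; apply: measurableI; rewrite ?mtype//;
    [|apply: measurableC]; exact: mV.
apply/seteqP; split => w /=; rewrite /types; case: eqVneq => [uV|/eqP uV].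
- by left.
- by right; split => //; apply/nesym.
- by move=> [[_ ->//]|[nV _]]; exfalso; exact/nV/esym.
- by move=> [[Vu _]|[_ ->//]]; exfalso; exact/uV/esym.
Qed.

Let measurable_restr_T_code n c :
  (forall j u, (j < n)%N -> measurable (V j @^-1` [set u])) ->
  measurable ((fun w => restr_code n (T w)) @^-1` [set c]).
Proof.
move=> mV; have [[t tc]|nc] := pselect (exists t, restr_code n t = c); last first.
  rewrite (_ : _ @^-1` _ = set0)//; apply/seteqP; split => // w /= wc.
  by apply: nc; exists (T w).
rewrite (_ : _ @^-1` _ = [set w | restr n (T w) = restr n t]).
  exact: measurable_restr_T.
by apply/seteqP; split => w /=; rewrite -tc => /restr_codeP.
Qed.

Let measurable_V n u : measurable (V n @^-1` [set u]).
Proof.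
elim/ltn_ind: n u => n IHn u.
have mV j v : (j < n)%N -> measurable (V j @^-1` [set v]) by move=> /IHn; apply.
(* Splitting along the countably many possible levels [L] replaces the choice variable with random
   index by one with fixed index. *)
rewrite (_ : _ @^-1` _ = \bigcup_(L in [set: {fset seq nat}])
  ((fun w => restr_code n (T w)) @^-1`
     [set c | exists2 t, restr_code n t = c & fset_set (level t n) = L] `&`
   X (inr (n, L)) @^-1` [set inr u])).
  apply: countable_bigcupT_measurable => [|L]; first exact: countableP.
  apply: measurableI => //; apply: measurable_preimage_fibers => c.
  exact: measurable_restr_T_code.
apply/seteqP; split => w /=.
  move=> wu; exists (fset_set (level (T w) n)) => //; split; first by exists (T w).
  by apply/choice_ofP; rewrite -VE.
move=> [_ _ [[t /restr_codeP tw <-] /choice_ofP]].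
by rewrite (restr_level (leqnn n) tw) -VE.
Qed.

Let measurable_T : measurable_fun setT (T : W -> mtreeF).
Proof.
apply: (@measurability _ _ W mtreeF setT T (\bigcup_n Fn n)) => //.
move=> _ [L [n _ /FnP FL] <-]; rewrite setTI.
rewrite (_ : _ @^-1` _ = (fun w => restr_code n (T w)) @^-1`
    [set c | exists2 t, restr_code n t = c & L t]).
  by apply: measurable_preimage_fibers => c; apply: measurable_restr_T_code => *;
    exact: measurable_V.
apply/seteqP; split => w /=; first by move=> LT; exists (T w).
by move=> [t /restr_codeP]; exact: FL.
Qed.

Let rvT : {RV Pr >-> mtreeF} := HB.pack (T : W -> mtreeF)
  (isMeasurableFun.Build _ _ W mtreeF T measurable_T).

Let uniform_choice t v n : level t n (v n) ->
  unif_law R (fset_set (level t n)) (v n) = (Zn n t)%:R^-1.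
Proof.
move=> /mem_level tv; rewrite /unif_law tv.
by case: eqVneq => // L0; move: tv; rewrite L0.
Qed.

Let historyE n k t v : history rvT V n k t v =
  [set w | restr n (T w) = restr n t /\ forall j, (j < k.+1)%N -> V j w = v j].
Proof. by apply/seteqP; split => w /= [Tt Vv]; split => // j; exact: Vv. Qed.

Lemma special_tree_construction :
  exists (T : {RV Pr >-> mtreeF}) (V : nat -> W -> seq nat), special_tree T V pn ps.
Proof.
exists rvT, V; split.
- exact: measurable_V.
- by move=> n; apply: aeW => w; exact: level_V.
- move=> n t v tv; rewrite !historyE !Pr_history ?leqnn ?leqnSn//.
  rewrite -EFinM big_belowS /=; congr EFin.
  (* One more generation adds the factors of level [n], among which only [v n] uses the special
     law. *)
  rewrite [X in _ * X * _](bigD1_seq (v n)) ?fset_uniq//=; last exact/mem_level.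
  have -> : size (v n) = n by case: tv.
  rewrite eqxx; set A := \prod_(u <- _) _; set B := \prod_(0 <= j < _) _.
  rewrite [X in _ * (_ * X)](_ : _ = \prod_(u <- fset_set (level t n) | u != v n)
    pn (nchild t u) (eta t u)); first by ring.
  rewrite big_seq_cond [RHS]big_seq_cond; apply: eq_bigr => u.
  by move=> /andP[/mem_level[_ ->] /negbTE ->].
- move=> n t v tv; rewrite !historyE !Pr_history ?leqnn ?leqnSn//.
  by rewrite -EFinM big_nat_recr//= uniform_choice// mulrA.
Qed.

End construction.

Lemma special_tree_exists :
  exists (d : measure_display) (W : measurableType d) (Pr : probability W R)
    (T : {RV Pr >-> mtreeF}) (V : nat -> W -> seq nat), special_tree T V pn ps.
Proof.
have [d [W [Pr [X [mX X0 X_indep]]]]] :=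
  independent_family special_law_ge0 esum_special_law.
by exists d, W, Pr; exact: special_tree_construction X_indep.
Qed.

End existence.

(** * From the law of special trees to the change of measure *)

Lemma special_tree_Qs2_formula (R : realType) (p q : nat -> R)
    (P : probability mtreeF R) (s kappa m : R) (d : measure_display)
    (W : measurableType d) (Pr : probability W R) (T : {RV Pr >-> mtreeF})
    (V : nat -> W -> seq nat) :
  marked_GW p q P -> 0 <= s -> 0 < kappa -> 0 <= m ->
  (forall k e, 0 <= p_normal p q s kappa k e) ->
  special_tree T V (p_normal p q s kappa) (p_special p q s kappa m) ->
  Qs2_formula P s kappa m (distribution Pr T).
Proof.
move=> hP s0 k0 m0 pn0 HT; apply: Qs2_formula_atoms => //; first exact: ltW.
move=> n t; apply: (etrans (special_tree_restr pn0 m0 (fun _ _ => erefl) HT n t)).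
have -> : P [set x | restr n x = restr n t] =
    (\prod_(u <- fset_set (below t n)) p0 p q (nchild t u) (eta t u))%:E.
  (* [marked_GW] starts at height 1; at height 0 the restriction is the same for all trees. *)
  case: n => [|n]; last exact: hP.
  rewrite below0 fset_set0 big_nil -(probability_setT P); congr (P _).
  by apply/seteqP; split => // x _; exact: restr_root.
rewrite -EFinM prod_p_normal ?gt_eqF//; congr EFin; rewrite /Qs2_density.
by ring.
Qed.

Unset Implicit Arguments.

Theorem theorem4p3 (R : realType) (p q : nat -> R)
    (hp : offspring_distribution p) (hp01 : p 0%N + p 1%N < 1)
    (hmean : finite_mean p) (hp0 : 0 < p 0%N)
    (hq : mark_function q) (hpq : exists k, 0 < p k * q k)
    (P : probability mtreeF R) (hP : marked_GW p q P)
    (s : R) (hs : 0 < s < 1)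
    (kappa : R)
    (hkappa : unique (fun t : R => 0 <= t <= 1 /\ fgen P s t = t) kappa) :
  let m := derive1 (fgen P s) kappa in
  let pn := p_normal p q s kappa in
  let ps := p_special p q s kappa m in
  exists Q : probability mtreeF R,
    [/\ Qs2_formula P s kappa m Q,
        (forall Q' : probability mtreeF R, Qs2_formula P s kappa m Q' ->
          forall A, measurable A -> Q' A = Q A),
        (exists (d : measure_display) (W : measurableType d)
           (Pr : probability W R) (T : {RV Pr >-> mtreeF})
           (V : nat -> W -> seq nat), special_tree T V pn ps)
      & (forall (d : measure_display) (W : measurableType d)
           (Pr : probability W R) (T : {RV Pr >-> mtreeF})
           (V : nat -> W -> seq nat), special_tree T V pn ps ->
          forall A, measurable A -> distribution Pr T A = Q A)].
Proof.
move=> m pn ps; have /andP[s0 s1] := hs; have [hk _] := hkappa.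
have k0 : 0 < kappa := fixed_point_gt0 hp hp0 hq hP hs hk.
have m0 : 0 < m := derive_fgen_gt0 hp hp01 hp0 hq hpq hP hs hk.
have pn0 : forall k e, 0 <= pn k e := p_normal_ge0 hp hp0 hq hP hs hk.
have formula (d : measure_display) (W : measurableType d) (Pr : probability W R)
    (T : {RV Pr >-> mtreeF}) (V : nat -> W -> seq nat) :
    special_tree T V pn ps -> Qs2_formula P s kappa m (distribution Pr T).
  by apply: special_tree_Qs2_formula => //; exact: ltW.
have unicity (Q Q' : probability mtreeF R) :
    Qs2_formula P s kappa m Q -> Qs2_formula P s kappa m Q' ->
    forall A, measurable A -> Q A = Q' A.
  by move=> HQ HQ'; apply: mtree_law_unique => n L FL; rewrite (HQ n L FL) (HQ' n L FL).
have ex : exists (d : measure_display) (W : measurableType d)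
    (Pr : probability W R) (T : {RV Pr >-> mtreeF}) (V : nat -> W -> seq nat),
    special_tree T V pn ps.
  exact: (special_tree_exists pn0 (ltW m0) (fun _ _ => erefl)
    (esum_p_normal hp hp0 hq hP hs hk)
    (esum_p_special hp hp01 hp0 hq hpq hP hs hk)).
(* Taking [Q] as the law of a constructed tree avoids having to check that the defining formula is
   consistent in n and extends to a measure. *)
have [d [W [Pr [T [V HT]]]]] := ex.
exists (distribution Pr T); split => //; first exact: formula HT.
- by move=> Q' HQ'; apply: unicity => //; exact: formula HT.
- move=> d' W' Pr' T' V' HT'; apply: unicity; first exact: formula HT'.
  exact: formula HT.
Qed.
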